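(* Let $L$ be a hyperbolic lattice of even rank $2d$ and let $G\subset \mathrm{SO}^+(L)$ be a subgroup. Assume that $G$ has no $G$-stable $\mathbb{R}$-linear subspace of $L_{\mathbb{R}}$ other than $\{0\}$ and $L_{\mathbb{R}}$. Then there is an element $g\in G$ whose characteristic polynomial is a Salem polynomial of degree $2d$.
   Context: A hyperbolic lattice is a free $\mathbb{Z}$-module $L$ of rank $1+t$, $t>0$, together with a $\mathbb{Z}$-valued symmetric bilinear form $(\cdot,\cdot)$ of signature $(1,t)$. Write $L_{\mathbb{R}}=L\otimes_{\mathbb{Z}}\mathbb{R}$. The set $\{x\in L_{\mathbb{R}} : (x,x)>0\}$ has two connected components $\pm C$. $\mathrm{O}(L)(\mathbb{Z})$ denotes the group of isometries of $L$, and $\mathrm{SO}^+(L)$ is the subgroup of those $g\in\mathrm{O}(L)(\mathbb{Z})$ with $\det g=1$ and $g(C)=C$. A Salem polynomial is an irreducible monic polynomial in $\mathbb{Z}[x]$ of even degree $2d\ge 2$ whose complex zeros are $a>1$, $1/a$, and $\alpha_i,\overline{\alpha}_i$ ($1\le i\le d-1$) with $\alpha_i\in\{z\in\mathbb{C} : |z|=1\}\setminus\{\pm1\}$. *)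

(* Defs.v *)
From HB Require Import structures.
From mathcomp Require Import all_boot all_order all_algebra.
From mathcomp Require Import all_classical all_reals all_analysis.
From mathcomp Require Import complex.

Set Implicit Arguments.
Unset Strict Implicit.
Unset Printing Implicit Defensive.

Import Order.TTheory GRing.Theory Num.Theory.
Import numFieldNormedType.Exports.

Local Open Scope classical_set_scope.
Local Open Scope ring_scope.

(* A lattice of rank n is given in coordinates: L is 'rV[int]_n, its form has
   Gram matrix S : 'M[int]_n, and L_R is 'rV[R]_n. Vectors being rows, an
   endomorphism with matrix g acts by x |-> x *m g. *)

Definition realmx (R : realType) (m n : nat) (M : 'M[int]_(m, n)) :
  'M[R]_(m, n) := map_mx intr M.

Definition bform (K : pzRingType) (n : nat) (S : 'M[K]_n) (x y : 'rV[K]_n) : K :=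
  (x *m S *m y^T) 0 0.

Definition has_signature (R : realType) (p q : nat) (S : 'M[R]_(p + q)) : Prop :=
  exists2 P : 'M[R]_(p + q), P \in unitmx
    & P *m S *m P^T = block_mx 1%:M 0 0 (- 1%:M).

Definition hyperbolic_lattice (R : realType) (t : nat) (S : 'M[int]_(1 + t)) :
    Prop :=
  [/\ (0 < t)%N,
      forall x y : 'rV[int]_(1 + t), bform S x y = bform S y x
    & has_signature (realmx R S)].

Definition positive_vectors (R : realType) (n : nat) (S : 'M[int]_n) :
  set 'rV[R]_n := [set x | 0 < bform (realmx R S) x x].

Definition positive_cone (R : realType) (n : nat) (S : 'M[int]_n)
    (C : set 'rV[R]_n) : Prop :=
  exists2 x, positive_vectors S x & C = connected_component (positive_vectors S) x.

Definition isometry (n : nat) (S g : 'M[int]_n) : Prop :=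
  g \in unitmx /\
  forall x y : 'rV[int]_n, bform S (x *m g) (y *m g) = bform S x y.

Definition SOplus (R : realType) (n : nat) (S : 'M[int]_n)
    (C : set 'rV[R]_n) : set 'M[int]_n :=
  [set g | [/\ isometry S g, \det g = 1 & [set x *m realmx R g | x in C] = C]].

Definition is_subgroup (n : nat) (H G : set 'M[int]_n) : Prop :=
  [/\ G `<=` H,
      G 1%:M,
      forall g h, G g -> G h -> G (g *m h)
    & forall g, G g -> G (invmx g)].

Definition stable (R : realType) (n : nat) (G : set 'M[int]_n)
    (V : {vspace 'rV[R]_n}) : Prop :=
  forall g, G g -> forall v, v \in V -> v *m realmx R g \in V.

(* Ring-theoretic irreducibility. MathComp's irreducible_poly over int is
   phrased with pseudo-division, hence only sees divisibility over rat. *)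
Definition irreducible_int_poly (p : {poly int}) : Prop :=
  [/\ p != 0,
      p \isn't a GRing.unit
    & forall q r : {poly int}, p = q * r ->
        q \is a GRing.unit \/ r \is a GRing.unit].

(* p is a Salem polynomial of degree 2 * d. *)
Definition salem_polynomial (R : realType) (d : nat) (p : {poly int}) : Prop :=
  [/\ (0 < d)%N,
      size p = (2 * d).+1,
      p \is monic,
      irreducible_int_poly p
    & exists (a : R) (alpha : 'I_d.-1 -> R[i]),
        [/\ 1 < a,
            forall i, [/\ `|alpha i| = 1, alpha i != 1 & alpha i != -1]
          & map_poly intr p =
              ('X - (a%:C%C)%:P) * ('X - ((a^-1)%:C%C)%:P)
              * \prod_(i < d.-1)
                  (('X - (alpha i)%:P) * ('X - ((alpha i)^*%C)%:P))]].

(* Main.v *)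
From mathcomp Require Import all_boot all_order all_algebra.
From mathcomp Require Import all_classical all_reals all_analysis.
From mathcomp Require Import complex ring lra zify.
Require Import Defs.
Set Implicit Arguments.
Unset Strict Implicit.
Unset Printing Implicit Defensive.

Import Order.TTheory GRing.Theory Num.Theory.
Import numFieldNormedType.Exports.

Local Open Scope classical_set_scope.
Local Open Scope ring_scope.

(** Why the theorem is true. Let n = 2d be the rank. An eigenvector of an isometry
    for an eigenvalue outside the closed unit disc is isotropic, and orthogonal
    isotropic vectors of a Lorentzian space are colinear. It follows that an
    isometry preserving the cone has either all its eigenvalues in the closed
    unit disc, or a simple real eigenvalue lam > 1, the eigenvalue 1/lam, and
    n - 2 eigenvalues of modulus 1 (salem_spectrum). By Kronecker's theorem an
    integral monic polynomial with all roots in the closed unit disc has only 0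
    and roots of unity as roots, of order dividing an integer N that depends on
    the degree alone. So if g in G has no eigenvalue alpha with alpha^N = 1, then
    every nontrivial factor of its characteristic polynomial has a root outside
    the disc; there is room for one such root only, hence the polynomial is
    irreducible and Salem (salem_char_poly). The problem is thus to find g in G
    with det (g^N - 1) not zero.

    The usual argument is that G is Zariski dense in SO(1, n-1), where the
    equation det (g^N - 1) = 0 is not an identity. Only an elementary fragment of
    this density is established here. First, G contains an element h with an
    eigenvalue lam > 1: otherwise the traces on G are bounded integers, G is finite
    because the trace form is nondegenerate on the irreducible algebra spanned by
    G, and a finite group fixes a vector of the cone
    (exists_expanding_element). Next, h is the product of a boost, which scales
    two isotropic vectors p and q by lam and 1/lam and fixes their orthogonal
    complement, and of a commuting rotation whose powers are bounded and return
    to any neighbourhood of 1. Comparing growth rates along these return times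
    shows that if det (Y^N - 1) vanishes for all Y = A h^k B, then it vanishes for
    all Y = A b B, where b is any boost along p and q (boost_propagation). So if det (g^N - 1) vanishes
    on G, it vanishes on a group containing G and all these boosts
    (closure_group).

    A boost along isotropic vectors a, b has the bivector of a and b as
    infinitesimal generator. The bivectors obtained from the conjugates of the
    boosts under this group span all bivectors (null_on_axes_eq0): the components
    of a bivector for the action of a boost stay in the span, and the endpoints
    of the axes span the space by irreducibility. Since n is even some
    combination X of generators is an invertible matrix. The group contains
    elements 1 + eps X + o(eps), for which det (g^N - 1) is equivalent to
    eps^n det (N X), and this is not zero (tangent_unit_det_neq0,
    exists_no_root_of_unity). *)

(** * Spanning families and irreducibility *)

(** A sequence of elements of X whose span has the largest possible dimension
    absorbs the rest of X. *)
Lemma exists_finite_spanning_seq (K : fieldType) (V : vectType K) (X : set V) :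
  exists s : seq V, (forall v, v \in s -> X v) /\ (forall v, X v -> v \in << s >>%VS).
Proof.
have H m : forall s : seq V, (forall v, v \in s -> X v) ->
    (\dim {:V} - \dim << s >> <= m)%N ->
  exists s : seq V, (forall v, v \in s -> X v) /\ (forall v, X v -> v \in << s >>%VS).
  elim: m => [|m IHm] s sX les.
    exists s; split=> // v _.
    suff -> : << s >>%VS = fullv by rewrite memvf.
    by apply/eqP; rewrite eqEdim subvf -subn_eq0 -leqn0.
  have [?|] := pselect (forall v, X v -> v \in << s >>%VS); first by exists s.
  move=> /existsNP[v /not_implyP[Xv /negP vs]].
  apply: (IHm (v :: s)).
    by move=> w; rewrite inE => /predU1P[->|/sX].
  have lt : (\dim << s >> < \dim << v :: s >>)%N.
    rewrite ltn_neqAle dimvS ?andbT; last first.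
      by apply/sub_span => w ws; rewrite inE ws orbT.
    apply: contra vs => /eqP e.
    suff -> : << s >>%VS = << v :: s >>%VS by rewrite memv_span ?mem_head.
    by apply/eqP; rewrite eqEdim e leqnn andbT; apply/sub_span => w ws; rewrite inE ws orbT.
  rewrite -ltnS; apply: leq_trans les; apply: ltn_sub2l => //.
  exact: leq_trans lt (dimvS (subvf _)).
by apply: (H (\dim {:V}) [::]) => //; rewrite leq_subr.
Qed.

Lemma span_ind (K : fieldType) (V : vectType K) (s : seq V) (P : V -> Prop) :
  P 0 -> (forall x y, P x -> P y -> P (x + y)) -> (forall c x, P x -> P (c *: x)) ->
  (forall x, x \in s -> P x) -> forall x, x \in << s >>%VS -> P x.
Proof.
move=> P0 PD PZ Ps x xs; rewrite (@coord_span _ _ _ (in_tuple s) x xs).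
by apply: (big_ind P) => // i _; apply: PZ; apply: Ps; rewrite mem_nth.
Qed.

Definition irreducible_on (K : fieldType) n (Gam : set 'M[K]_n) :=
  forall V : {vspace 'rV[K]_n},
    (forall y, Gam y -> forall v, v \in V -> v *m y \in V) -> V = 0%VS \/ V = fullv.

Lemma irreducible_spanning (K : fieldType) n (Gam : set 'M[K]_n) (X : set 'rV[K]_n) x :
  irreducible_on Gam -> (forall y v, Gam y -> X v -> X (v *m y)) ->
  X x -> x != 0 ->
  exists s : seq 'rV[K]_n, (forall v, v \in s -> X v) /\ << s >>%VS = fullv.
Proof.
move=> irr stX Xx x0; have [s [sX Xs]] := exists_finite_spanning_seq X.
exists s; split=> //; have [y yG|s0|//] := irr << s >>%VS.
  apply: span_ind.
  - by rewrite mul0mx mem0v.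
  - by move=> u v uV vV; rewrite mulmxDl memvD.
  - by move=> c u uV; rewrite -scalemxAl memvZ.
  - by move=> u /sX Xu; apply: Xs; apply: stX.
by have := Xs _ Xx; rewrite s0 memv0 (negPf x0).
Qed.

(** * Eigenvalues through power sums *)

(** By linearity the hypothesis gives sum_i P(r_i) F(r_i) = 0 for every
    polynomial P of degree less than n. Choosing P to vanish at all the values
    other than r_i0 leaves a positive multiple of P(r_i0) F(r_i0). *)
Lemma power_sums_eq0 (C : numFieldType) (n : nat) (r : 'I_n -> C) (F : C -> C) :
  (forall j, (j < n)%N -> \sum_i r i ^+ j * F (r i) = 0) ->
  forall i, F (r i) = 0.
Proof.
move=> sum0 i0.
pose P := \prod_(z <- rem (r i0) (undup (codom r))) ('X - z%:P).
have un : uniq (undup (codom r)) by exact: undup_uniq.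
have r0 : r i0 \in undup (codom r) by rewrite mem_undup codom_f.
have sP : (size P <= n)%N.
  rewrite size_prod_XsubC size_rem //.
  rewrite prednK; last by case: (undup _) r0.
  by rewrite (leq_trans (size_undup _)) // size_codom card_ord.
have Pr i : r i != r i0 -> P.[r i] = 0.
  move=> ne; apply/rootP; rewrite root_prod_XsubC mem_rem_uniq // inE ne /=.
  by rewrite mem_undup codom_f.
have P0 : P.[r i0] != 0.
  by rewrite -[_ == 0]/(root _ _) root_prod_XsubC mem_rem_uniq // !inE eqxx.
have : \sum_i P.[r i] * F (r i) = 0.
  transitivity (\sum_(j < n) P`_j * \sum_i r i ^+ j * F (r i)); last first.
    by apply: big1 => j _; rewrite sum0 ?mulr0.
  under [RHS]eq_bigr do rewrite mulr_sumr.
  rewrite exchange_big /=; apply: eq_bigr => i _.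
  by rewrite (horner_coef_wide _ sP) mulr_suml; apply: eq_bigr => j _; rewrite mulrA.
rewrite (bigID (fun i => r i == r i0)) /= [X in _ + X]big1 ?addr0; last first.
  by move=> i ne; rewrite Pr ?mul0r.
rewrite (eq_bigr (fun=> P.[r i0] * F (r i0))); last by move=> i /eqP->.
rewrite sumr_const => /eqP; rewrite mulrn_eq0 => /orP[/eqP c0|].
  by move: (card0_eq c0 i0); change ((r i0 == r i0) = false -> F (r i0) = 0); rewrite eqxx.
by rewrite mulf_eq0 (negPf P0) => /eqP.
Qed.

Lemma char_poly_similar (F : fieldType) (n : nat) (P A B : 'M[F]_n) :
  P \in unitmx -> P *m A = B *m P -> char_poly A = char_poly B.
Proof.
move=> Pu PAB.
have dP : \det (map_mx polyC P) != 0.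
  by rewrite det_map_mx polyC_eq0 -unitfE -unitmxE.
apply: (mulfI dP); rewrite /char_poly [RHS]mulrC -!det_mulmx; congr (\det _).
rewrite /char_poly_mx mulmxBr mulmxBl -!map_mxM PAB.
by rewrite scalar_mxC.
Qed.

Lemma trigmxM (F : comNzRingType) n (A B : 'M[F]_n) :
  is_trig_mx A -> is_trig_mx B ->
  is_trig_mx (A *m B) /\ forall i, (A *m B) i i = A i i * B i i.
Proof.
move=> /is_trig_mxP At /is_trig_mxP Bt; split.
  apply/is_trig_mxP => i j ij; rewrite mxE big1 // => k _.
  have [ik|ki] := ltnP i k; first by rewrite At ?mul0r.
  by rewrite Bt ?mulr0 // (leq_ltn_trans ki).
move=> i; rewrite mxE (bigD1 i) //= big1 ?addr0 // => k ki.
have [ik|ki'] := ltnP i k; first by rewrite At ?mul0r.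
by rewrite Bt ?mulr0 // ltn_neqAle ki' andbT val_eqE.
Qed.

(** The tuple is the diagonal of a Schur triangulation of M, on which taking
    powers acts entrywise. *)
Lemma exists_eigenvalue_tuple (C : numClosedFieldType) (n : nat) (M : 'M[C]_n.+1) :
  exists r : 'I_n.+1 -> C, char_poly M = \prod_i ('X - (r i)%:P) /\
    forall j, \tr (M ^+ j) = \sum_i r i ^+ j.
Proof.
have [P Pu] := Schur M (ltn0Sn n).
have {Pu}Pu := unitarymx_unit Pu.
rewrite /similar_to conjumx // => Tt.
set T := P *m M *m invmx P in Tt; have PT : P *m M = T *m P by rewrite mulmxKV.
exists (fun i => T i i); split.
  by rewrite (char_poly_similar Pu PT) char_poly_trig.
have Tj j : is_trig_mx (T ^+ j) /\ forall i, (T ^+ j) i i = T i i ^+ j.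
  elim: j => [|j [IH1 IH2]].
    by split=> [|i]; rewrite ?expr0 ?mxE ?eqxx // scalar_mx_is_trig.
  rewrite exprS; have [? e] := trigmxM Tt IH1; split=> // i.
  by rewrite e IH2 exprS.
move=> j; rewrite -(eq_bigr _ (fun i _ => (Tj j).2 i)) -/(\tr _).
have PTj : P *m M ^+ j = T ^+ j *m P.
  elim: j => [|j IH]; first by rewrite !expr0 mulmx1 mul1mx.
  by rewrite exprSr -mulmxE mulmxA IH -mulmxA PT mulmxA exprSr.
by rewrite -[T ^+ j](mulmxK Pu) -PTj -mulmxA mxtrace_mulC mulmxKV.
Qed.

(** * Kronecker's theorem *)

(** Integers bounded by k leave finitely many windows (s_j, ..., s_(j+k-1)), so
    the windows starting at some a < b coincide. Then power_sums_eq0, applied to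
    z^a - z^b, gives r_i^a = r_i^b. *)
Lemma bounded_power_sums_periodic (C : numClosedFieldType) (k : nat)
    (r : 'I_k -> C) (s : nat -> int) :
  (forall j, (s j)%:~R = \sum_i r i ^+ j) -> (forall i, `|r i| <= 1) ->
  exists D, (0 < D <= (k.*2.+1) ^ k)%N /\ forall i, r i != 0 -> r i ^+ D = 1.
Proof.
move=> sE r1.
have sb j : (`|s j| <= k)%N.
  rewrite -lez_nat abszE -(ler_int C) intr_norm sE.
  apply: le_trans (ler_norm_sum _ _ _) _.
  rewrite -pmulrn -[k in leRHS]card_ord -sum1_card natr_sum.
  apply: ler_sum => i _; rewrite normrX; exact: exprn_ile1.
pose K := (k.*2.+1 ^ k)%N.
(* Adding k turns the sums into natural numbers at most 2k. *)
pose f (j : 'I_K.+1) : {ffun 'I_k -> 'I_k.*2.+1} :=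
  [ffun i : 'I_k => inord (absz (s (j + i)%N + k%:Z)%R)].
have : ~ injective f.
  move=> inj; have := leq_card f inj.
  by rewrite card_ord card_ffun !card_ord ltnn.
move=> /existsNP[a] /existsNP[b] /not_implyP[fab /eqP nab].
wlog lt : a b fab nab / (a < b)%N.
  move=> H; case: (ltngtP a b) => ab; first exact: (H a b).
    by apply: (H b a) => //; rewrite eq_sym.
  by move: nab; rewrite -val_eqE /= ab eqxx.
exists (b - a)%N; split.
  by rewrite subn_gt0 lt /= (leq_trans (leq_subr _ _)) // -ltnS.
have key : forall i, (fun z => z ^+ a - z ^+ b) (r i) = 0.
  apply: (@power_sums_eq0 _ _ r (fun z => z ^+ a - z ^+ b)) => j jk.
  have := congr1 (fun g : {ffun 'I_k -> 'I_k.*2.+1} => val (g (Ordinal jk))) fab.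
  rewrite !ffunE /= !inordK; [|have := sb (b + j)%N; lia|have := sb (a + j)%N; lia].
  move=> e.
  have e' : s (a + j)%N = s (b + j)%N by have := sb (a + j)%N; have := sb (b + j)%N; lia.
  under eq_bigr do rewrite mulrBr -!exprD ![(j + _)%N]addnC.
  by rewrite sumrB -!sE e' subrr.
move=> i r0; have /eqP := key i.
rewrite subr_eq0 -(subnK (ltnW lt)) exprD addnK eq_sym -subr_eq0 -{2}[r i ^+ a]mul1r -mulrBl.
by rewrite mulf_eq0 expf_eq0 (negPf r0) andbF orbF subr_eq0 => /eqP.
Qed.

Lemma exists_companion (R : comNzRingType) (k : nat) (q : {poly R}) :
  q \is monic -> size q = k.+1 -> exists M : 'M[R]_k, char_poly M = q.
Proof.
move=> mon sq; have := companionmxK mon; move: (companionmx q).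
by rewrite sq /= => M <-; exists M.
Qed.

(** The power sums of the roots of q are the traces of the powers of its
    companion matrix, hence integers, and they are bounded when the roots lie in
    the closed unit disc. The exponent is uniform in q because the factorial
    absorbs all the periods that the pigeonhole principle can produce. *)
Theorem kronecker (C : numClosedFieldType) (n : nat) :
  exists N, (0 < N)%N /\ forall q : {poly int}, q \is monic -> (size q <= n.+1)%N ->
    (forall z : C, root (map_poly intr q) z -> `|z| <= 1) ->
    forall z : C, root (map_poly intr q) z -> z != 0 -> z ^+ N = 1.
Proof.
exists ((n.*2.+1 ^ n)`!); split; first exact: fact_gt0.
move=> q mon sq q1 z qz z0.
case sqE : (size q) => [|[|k]].
- by move: mon; rewrite monicE lead_coefE; move/eqP: sqE; rewrite size_poly_eq0 => /eqP->; rewrite coef0 eq_sym oner_eq0.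
- move: qz; have := size1_polyC (eq_leq sqE) => qE.
  move: mon; rewrite qE monicE lead_coefC => /eqP->.
  by rewrite rmorph1 (negPf (root1 z)).
have [M ME] := exists_companion mon sqE.
have [r [rE rT]] := exists_eigenvalue_tuple (map_mx (intr : int -> C) M).
rewrite -map_char_poly ME -(big_map r predT (fun a => 'X - a%:P)) in rE.
have rr i : root (map_poly intr q) (r i).
  by rewrite rE root_prod_XsubC; apply/mapP; exists i; rewrite ?mem_index_enum.
have [D [Db DE]] := @bounded_power_sums_periodic C k.+1 r (fun j => \tr (M ^+ j))
  (fun j => etrans (etrans (esym (trace_map_mx _ _)) (congr1 _ (rmorphXn _ _ _))) (rT j)) (fun i => q1 _ (rr i)).
have [i zi] : exists i, z = r i.
  by move: qz; rewrite rE root_prod_XsubC => /mapP[i _ ->]; exists i.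
have /dvdnP[m ->] : (D %| (n.*2.+1 ^ n)`!)%N.
  apply: dvdn_fact; case/andP: Db => -> /= h; apply: leq_trans h _.
  have kn : (k.+1 <= n)%N by move: sq; rewrite sqE.
  apply: leq_trans (leq_pexp2l _ kn) => //.
  by rewrite leq_exp2r // ltnS leq_double.
by rewrite mulnC exprM zi DE ?expr1n // -zi.
Qed.

(** * Bilinear forms and isometries *)

Section BilinearForm.
Variables (K : comNzRingType) (n : nat) (S : 'M[K]_n).
Implicit Types x y z : 'rV[K]_n.

Lemma bformDl x y z : bform S (x + y) z = bform S x z + bform S y z.
Proof. by rewrite /bform !mulmxDl mxE. Qed.

Lemma bformDr x y z : bform S z (x + y) = bform S z x + bform S z y.
Proof. by rewrite /bform linearD /= mulmxDr mxE. Qed.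

Lemma bformZl a x y : bform S (a *: x) y = a * bform S x y.
Proof. by rewrite /bform -!scalemxAl mxE. Qed.

Lemma bformZr a x y : bform S x (a *: y) = a * bform S x y.
Proof. by rewrite /bform linearZ /= -!scalemxAr mxE. Qed.

Lemma bformNl x y : bform S (- x) y = - bform S x y.
Proof. by rewrite -scaleN1r bformZl mulN1r. Qed.

Lemma bformNr x y : bform S y (- x) = - bform S y x.
Proof. by rewrite -scaleN1r bformZr mulN1r. Qed.

Lemma bform0l x : bform S 0 x = 0.
Proof. by rewrite /bform !mul0mx mxE. Qed.

Lemma bform0r x : bform S x 0 = 0.
Proof. by rewrite /bform trmx0 mulmx0 mxE. Qed.

Lemma bform_sumr I (r : seq I) (P : pred I) (F : I -> 'rV[K]_n) x :
  bform S x (\sum_(i <- r | P i) F i) = \sum_(i <- r | P i) bform S x (F i).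
Proof.
by apply: (big_morph (fun z => bform S x z)); [move=> ? ?; exact: bformDr|exact: bform0r].
Qed.

Lemma bform_trmx x y : bform S^T x y = bform S y x.
Proof.
rewrite /bform -[in RHS](trmxK (y *m S *m x^T)) [RHS]mxE.
by rewrite !trmx_mul trmxK mulmxA.
Qed.

Lemma bformC x y : S^T = S -> bform S x y = bform S y x.
Proof. by move=> symS; rewrite -bform_trmx symS. Qed.

Lemma bform_mx11 x y : x *m S *m y^T = (bform S x y)%:M.
Proof. by rewrite [LHS]mx11_scalar. Qed.

Lemma bform_isometry g x y : g *m S *m g^T = S ->
  bform S (x *m g) (y *m g) = bform S x y.
Proof. by move=> e; rewrite /bform trmx_mul !mulmxA -(mulmxA x g) -(mulmxA x) e. Qed.

Lemma bform_inj A B : (forall x y, bform A x y = bform B x y :> K) -> A = B :> 'M[K]_n.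
Proof.
move=> e; apply/matrixP => i j; have := e (delta_mx 0 i) (delta_mx 0 j).
by rewrite /bform !trmx_delta -!rowE -!colE !mxE.
Qed.

End BilinearForm.

Lemma isometry_unitmx (K : fieldType) n (S g : 'M[K]_n) :
  S \in unitmx -> g *m S *m g^T = S -> g \in unitmx.
Proof.
move=> Su gS; have := Su; rewrite -{1}gS !unitmx_mul unitmx_tr.
by case/andP => /andP[].
Qed.

Lemma isometry_invmx (K : fieldType) n (S g : 'M[K]_n) :
  g \in unitmx -> g *m S *m g^T = S -> invmx g *m S *m (invmx g)^T = S.
Proof.
move=> gu gS; rewrite -{1}gS trmx_inv !mulmxA mulVmx // mul1mx.
by rewrite mulmxK // unitmx_tr.
Qed.

(** * Lorentzian forms *)

(** Index at most one, stated without coordinates: the kernel of l is a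
    hyperplane on which the form is negative definite. *)
Definition lorentzian (R : realFieldType) (n : nat) (S : 'M[R]_n) :=
  exists l : 'cV[R]_n, forall z, z *m l = 0 -> z != 0 -> bform S z z < 0.

Section Lorentz.
Variables (R : realFieldType) (n : nat) (S : 'M[R]_n).
Hypotheses (symS : S^T = S) (lorS : lorentzian S).
Implicit Types x y z : 'rV[R]_n.

(** The combination l(x) y - l(y) x lies in the negative definite hyperplane,
    but its square is l(x)^2 (y,y) + l(y)^2 (x,x), which is nonnegative. *)
Lemma nonneg_orthogonal_colinear x y : x != 0 ->
  0 <= bform S x x -> 0 <= bform S y y -> bform S x y = 0 ->
  exists c, y = c *: x.
Proof.
move=> x0 xx yy xy; have [l lS] := lorS.
pose lx := (x *m l) 0 0; pose ly := (y *m l) 0 0.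
have xl : x *m l = lx%:M by exact: mx11_scalar.
have yl : y *m l = ly%:M by exact: mx11_scalar.
have lx0 : lx != 0.
  apply: contraL xx => /eqP lx0; rewrite -ltNge; apply: lS => //.
  by rewrite xl lx0; apply/matrixP => i j; rewrite !mxE mul0rn.
exists (ly / lx).
apply: (scalerI lx0); rewrite scalerA mulrC divfK //.
apply/eqP; rewrite -subr_eq0; apply: contraT => z0.
have : bform S (lx *: y - ly *: x) (lx *: y - ly *: x) < 0.
  apply: lS => //; rewrite mulmxBl -!scalemxAl xl yl.
  by apply/matrixP => i j; rewrite !mxE mulrnAr mulrnAr mulrC subrr.
rewrite bformDl !bformDr !bformNl !bformNr !bformZl !bformZr (bformC y x symS) xy.
rewrite ltNge => /negP[]; have h1 := sqr_ge0 lx; have h2 := sqr_ge0 ly.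
have h3 := mulr_ge0 h1 yy; have h4 := mulr_ge0 h2 xx; lra.
Qed.

Lemma timelike_orthogonal_neg x y : 0 < bform S x x -> bform S x y = 0 ->
  y != 0 -> bform S y y < 0.
Proof.
move=> xx xy y0; rewrite ltNge; apply/negP => yy.
have x0 : x != 0 by apply: contraTneq xx => ->; rewrite bform0l ltxx.
have [c yE] := nonneg_orthogonal_colinear x0 (ltW xx) yy xy.
move: xy; rewrite yE bformZr => /eqP; rewrite mulf_eq0 (gt_eqF xx) orbF => /eqP c0.
by move: y0; rewrite yE c0 scale0r eqxx.
Qed.

Lemma isometry_eigen_isotropic (g : 'M[R]_n) (a : R) x : g *m S *m g^T = S ->
  x *m g = a *: x -> a ^+ 2 != 1 -> bform S x x = 0.
Proof.
move=> gS xg a1; have := bform_isometry x x gS.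
rewrite xg bformZl bformZr mulrA -expr2 -[X in _ = X]mul1r => /eqP.
by rewrite -subr_eq0 -mulrBl mulf_eq0 subr_eq0 (negPf a1) => /eqP.
Qed.

(** Here v = x + i y is an eigenvector for mu = a + i b with |mu| > 1. Invariance
    of the form gives (v, v) = 0 because mu^2 is not 1, and (v, conj v) = 0
    because |mu| is not 1. So x and y are isotropic and orthogonal, hence
    colinear, and mu is real. *)
Lemma isometry_eigenpair_real (g : 'M[R]_n) (a b : R) x y : g *m S *m g^T = S ->
  x != 0 \/ y != 0 ->
  x *m g = a *: x - b *: y -> y *m g = b *: x + a *: y ->
  1 < a ^+ 2 + b ^+ 2 ->
  b = 0 /\ exists2 p : 'rV[R]_n, p != 0 & p *m g = a *: p.
Proof.
move=> gS xy0 xg yg m1.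
have := bform_isometry x x gS; have := bform_isometry y y gS; have := bform_isometry x y gS.
rewrite xg yg !(bformDl, bformDr, bformNl, bformNr, bformZl, bformZr) (bformC y x symS).
set X := bform S x x; set Y := bform S y y; set Z := bform S x y => eZ eY eX.
have XY : X + Y = 0.
  have : (a ^+ 2 + b ^+ 2 - 1) * (X + Y) = 0 by lra.
  by move/eqP; rewrite mulf_eq0 subr_eq0 (gt_eqF m1) => /eqP.
have {XY}YE : Y = - X by lra.
(* D is |mu^2 - 1|^2, and e1, e2 below say that (mu^2 - 1) (X + i Z) = 0. *)
pose D := (a ^+ 2 - b ^+ 2 - 1) ^+ 2 + (2 * a * b) ^+ 2.
have D0 : 0 < D.
  have -> : D = (a ^+ 2 + b ^+ 2 - 1) ^+ 2 + (2 * b) ^+ 2 by rewrite /D; ring.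
  by rewrite ltr_wpDr ?sqr_ge0 // exprn_gt0 // subr_gt0.
rewrite YE in eX eY eZ.
have e1 : (a ^+ 2 - b ^+ 2 - 1) * X = (2 * a * b) * Z by lra.
have e2 : (a ^+ 2 - b ^+ 2 - 1) * Z = - ((2 * a * b) * X) by lra.
have X0 : X = 0.
  have : D * X = 0.
    transitivity ((a ^+ 2 - b ^+ 2 - 1) * ((a ^+ 2 - b ^+ 2 - 1) * X)
      - (2 * a * b) * - ((2 * a * b) * X)); first by rewrite /D; ring.
    by rewrite e1 -e2; ring.
  by move/eqP; rewrite mulf_eq0 (gt_eqF D0) => /eqP.
have Z0 : Z = 0.
  have : D * Z = 0.
    transitivity ((a ^+ 2 - b ^+ 2 - 1) * ((a ^+ 2 - b ^+ 2 - 1) * Z)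
      + (2 * a * b) * ((2 * a * b) * Z)); first by rewrite /D; ring.
    by rewrite e2 -e1; ring.
  by move/eqP; rewrite mulf_eq0 (gt_eqF D0) => /eqP.
have [x0|x0] := eqVneq x 0.
  case: xy0 => [/eqP//|y0].
  move: xg yg; rewrite x0 mul0mx !scaler0 sub0r add0r => /esym/eqP.
  rewrite oppr_eq0 scaler_eq0 (negPf y0) orbF => /eqP b0 yg.
  by split=> //; exists y.
have [c yE] : exists c, y = c *: x.
  apply: nonneg_orthogonal_colinear => //; first by rewrite -/X X0.
  by rewrite -/Y YE X0 oppr0.
have b0 : b = 0.
  move: yg; rewrite yE -scalemxAl xg yE !scalerA -scaleNr -!scalerDl scalerA => /eqP.
  rewrite -subr_eq0 -scalerBl scaler_eq0 (negPf x0) orbF => /eqP e.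
  have : b * (1 + c ^+ 2) = 0 by lra.
  move/eqP; rewrite mulf_eq0 => /orP[/eqP//|].
  by rewrite gt_eqF // ltr_pwDl // sqr_ge0.
by split=> //; exists x => //; rewrite xg b0 scale0r subr0.
Qed.

(** Writing x = c f + y with y orthogonal to f, the value is 2 c^2 - (y, y): the
    sign of the form is flipped on the negative definite complement of f. *)
Lemma timelike_posdef f x : bform S f f = 2 -> x != 0 ->
  0 < bform S x f ^+ 2 - bform S x x.
Proof.
move=> ff x0.
have [c [y [xE fy]]] : exists c y, x = c *: f + y /\ bform S f y = 0.
  exists (bform S x f / 2), (x - (bform S x f / 2) *: f); split; first by rewrite addrC subrK.
  by rewrite bformDr bformNr bformZr ff (bformC f x symS); lra.
have -> : bform S x f ^+ 2 - bform S x x = 2 * c ^+ 2 - bform S y y.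
  rewrite xE !(bformDl, bformDr, bformZl, bformZr) (bformC y f symS) fy ff; ring.
have [y0|y0] := eqVneq y 0.
  rewrite y0 bform0l subr0 mulr_gt0 // lt_neqAle sqr_ge0 andbT eq_sym sqrf_eq0.
  by apply: contra x0 => /eqP c0; rewrite xE y0 c0 scale0r addr0.
have := timelike_orthogonal_neg (x := f) (y := y).
rewrite ff => /(_ (ltr0Sn _ 1) fy y0) h; have := sqr_ge0 c; lra.
Qed.

End Lorentz.

(** The vector x + i y is a complex eigenvector of M for al. *)
Lemma real_eigenpair (R : rcfType) (n : nat) (M : 'M[R]_n) (al : R[i]) :
  root (char_poly (map_mx (real_complex R) M)) al ->
  exists x y : 'rV[R]_n, [/\ x != 0 \/ y != 0,
    x *m M = complex.Re al *: x - complex.Im al *: y &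
    y *m M = complex.Im al *: x + complex.Re al *: y].
Proof.
rewrite -eigenvalue_root_char => /eigenvalueP[v vM v0].
have ReD (u w : R[i]) : complex.Re (u + w) = complex.Re u + complex.Re w by case: u w => [? ?] [? ?].
have ImD (u w : R[i]) : complex.Im (u + w) = complex.Im u + complex.Im w by case: u w => [? ?] [? ?].
exists (map_mx (@complex.Re R) v), (map_mx (@complex.Im R) v); split.
- have [x0|] := eqVneq (map_mx (@complex.Re R) v) 0; last by left.
  right; apply: contra v0 => /eqP y0; apply/eqP/matrixP => i j.
  have := congr1 (fun A : 'rV[R]_n => A i j) x0; have := congr1 (fun A : 'rV[R]_n => A i j) y0.
  by rewrite !mxE; case: (v i j) => a b /= -> ->.
- apply/matrixP => i j; have := congr1 (fun A : 'rV[R[i]]_n => complex.Re (A i j)) vM.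
  rewrite !mxE (big_morph _ ReD (erefl _)) => e.
  transitivity (\sum_j0 complex.Re (v i j0 * (map_mx (real_complex R) M) j0 j)).
    by apply: eq_bigr => k _; rewrite !mxE; case: (v i k) => a b /=; rewrite mulr0 subr0.
  by rewrite e; case: (v i j) al {e vM} => a b [c d].
- apply/matrixP => i j; have := congr1 (fun A : 'rV[R[i]]_n => complex.Im (A i j)) vM.
  rewrite !mxE (big_morph _ ImD (erefl _)) => e.
  transitivity (\sum_j0 complex.Im (v i j0 * (map_mx (real_complex R) M) j0 j)).
    by apply: eq_bigr => k _; rewrite !mxE; case: (v i k) => a b /=; rewrite mulr0 add0r.
  by rewrite e; case: (v i j) al {e vM} => a b [c d] /=; rewrite addrC.
Qed.

(** * Boosts and loxodromic isometries *)

Lemma eq_row_action (K : comNzRingType) m n (A B : 'M[K]_(m, n)) :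
  (forall x : 'rV_m, x *m A = x *m B) -> A = B.
Proof. by move=> e; apply/row_matrixP => i; rewrite !rowE e. Qed.

(** Both sides are the determinant of the block matrix with rows (1, -r) and
    (c, 1), reduced by block elimination on either side. *)
Lemma det_add_rank1 (K : comNzRingType) n (c : 'cV[K]_n) (r : 'rV[K]_n) :
  \det (1%:M + c *m r) = 1 + (r *m c) 0 0.
Proof.
pose B : 'M[K]_(1 + n) := block_mx 1%:M (- r) c 1%:M.
have e1 : B = block_mx 1%:M 0 c 1%:M *m block_mx 1%:M (- r) 0 (1%:M + c *m r).
  rewrite mulmx_block !mulmx1 !mul1mx !mul0mx !addr0 mulmxN.
  by rewrite addrCA addrA addrNK ?addNr ?add0r.
have e2 : B = block_mx (1%:M + r *m c) (- r) 0 1%:M *m block_mx 1%:M 0 c 1%:M.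
  rewrite mulmx_block !mulmx1 !mul1mx !mulmx0 !add0r mulNmx.
  by rewrite addrK.
have := congr1 determinant (etrans (esym e1) e2).
rewrite !det_mulmx !det_lblock !det_ublock !det1 !mul1r !mulr1 => ->.
by rewrite [_ + _]mx11_scalar det_scalar1 !mxE.
Qed.

Section Boost.
Variables (R : realFieldType) (n : nat) (S : 'M[R]_n.+1).
Hypothesis symS : S^T = S.
Implicit Types p q x y : 'rV[R]_n.+1.

(** For a hyperbolic pair: the projection onto the line of p along the orthogonal
    complement of q. *)
Definition light_proj p q : 'M[R]_n.+1 := S *m q^T *m p.

(** For a hyperbolic pair: p is multiplied by z, q by 1/z, and the orthogonal
    complement of their plane is fixed. *)
Definition boost p q (z : R) : 'M[R]_n.+1 :=
  1%:M + (z - 1) *: light_proj p q + (z^-1 - 1) *: light_proj q p.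

Definition hyperbolic_pair p q :=
  [/\ bform S p p = 0, bform S q q = 0 & bform S p q = 1].

Lemma light_projE p q x : x *m light_proj p q = bform S x q *: p.
Proof. by rewrite /light_proj !mulmxA bform_mx11 mul_scalar_mx. Qed.

Lemma boostE p q z x :
  x *m boost p q z = x + ((z - 1) * bform S x q) *: p + ((z^-1 - 1) * bform S x p) *: q.
Proof. by rewrite /boost !mulmxDr mulmx1 -!scalemxAr !light_projE !scalerA. Qed.

Lemma boost_conj p q z (y : 'M[R]_n.+1) : y *m S *m y^T = S ->
  boost p q z *m y = y *m boost (p *m y) (q *m y) z.
Proof.
move=> yS; apply: eq_row_action => x; rewrite !mulmxA !boostE !mulmxDl -!scalemxAl.
by rewrite !bform_isometry.
Qed.

Section Pair.
Variables p q : 'rV[R]_n.+1.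
Hypothesis pq : hyperbolic_pair p q.

Let pp : bform S p p = 0. Proof. by case: pq. Qed.
Let qq : bform S q q = 0. Proof. by case: pq. Qed.
Let pq1 : bform S p q = 1. Proof. by case: pq. Qed.
Let qp1 : bform S q p = 1. Proof. by rewrite bformC. Qed.

Lemma boost1 : boost p q 1 = 1%:M.
Proof. by rewrite /boost invr1 subrr !scale0r !addr0. Qed.

Lemma boostM z w : z != 0 -> w != 0 ->
  boost p q z *m boost p q w = boost p q (z * w).
Proof.
move=> z0 w0; apply: eq_row_action => x; rewrite !mulmxA !boostE.
rewrite !(bformDl, bformZl) pp qq pq1 qp1 !mulr0 !mulr1 !addr0 -!addrA.
by apply/matrixP => i j; rewrite !mxE; field; rewrite z0 w0.
Qed.

Lemma boost_isometry z : z != 0 ->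
  boost p q z *m S *m (boost p q z)^T = S.
Proof.
move=> z0; apply: bform_inj => x y.
rewrite /bform !mulmxA -mulmxA -trmx_mul -/(bform S (x *m boost p q z) (y *m boost p q z)).
rewrite !boostE !(bformDl, bformDr, bformZl, bformZr) pp qq pq1 qp1.
rewrite !(bformC p y, bformC q y) // -/(bform S x y); field; exact: z0.
Qed.

(** Multiplied by z, a boost becomes a polynomial in z, which allows identities
    in z to be tested on the powers of a single number. *)
Lemma boost_scaled z : z != 0 ->
  z *: boost p q z = z *: (1%:M - light_proj p q - light_proj q p)
    + z ^+ 2 *: light_proj p q + light_proj q p.
Proof.
move=> z0; rewrite /boost; apply/matrixP => i j; rewrite !mxE; field; exact: z0.
Qed.

Lemma light_projMC : light_proj p q *m light_proj q p = 0.
Proof.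
apply: eq_row_action => x.
by rewrite mulmxA !light_projE bformZl pp mulr0 scale0r mulmx0.
Qed.

Section Loxodromic.
Variables (h : 'M[R]_n.+1) (lam : R).
Hypotheses (hS : h *m S *m h^T = S) (lam0 : lam != 0).
Hypotheses (ph : p *m h = lam *: p) (qh : q *m h = lam^-1 *: q).

(** What remains of h once its boost is divided out: an isometry fixing p and q,
    which therefore acts on a definite complement. *)
Definition rotation_part := boost p q lam^-1 *m h.
Local Notation rho := rotation_part.

Lemma boost_commute z : boost p q z *m h = h *m boost p q z.
Proof.
rewrite boost_conj // ph qh; congr (_ *m _); apply: eq_row_action => x.
have e1 c t : c * (lam^-1 * t) * lam = c * t by field; exact: lam0.
have e2 c t : c * (lam * t) / lam = c * t by field; exact: lam0.
by rewrite !boostE !bformZr !scalerA e1 e2.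
Qed.

Lemma rotation_isometry : rho *m S *m rho^T = S.
Proof.
rewrite /rotation_part trmx_mul !mulmxA -(mulmxA _ h) -(mulmxA _ (h *m S)) hS.
by rewrite boost_isometry // invr_eq0.
Qed.

Lemma rotation_fixl : p *m rho = p.
Proof.
rewrite mulmxA boostE pp pq1 mulr0 scale0r addr0 mulr1 -{1}[p]scale1r -scalerDl.
by rewrite addrC subrK -scalemxAl ph scalerA mulVf ?scale1r.
Qed.

Lemma rotation_fixr : q *m rho = q.
Proof.
rewrite mulmxA boostE qq qp1 mulr0 scale0r addr0 mulr1 -{1}[q]scale1r -scalerDl.
by rewrite addrC subrK invrK -scalemxAl qh scalerA mulfV ?scale1r.
Qed.

Lemma boost_rotation : h = boost p q lam *m rho.
Proof. by rewrite mulmxA boostM ?invr_eq0 // mulfV // boost1 mul1mx. Qed.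

Lemma lox_powerE k : h ^+ k = boost p q (lam ^+ k) *m rho ^+ k.
Proof.
have rh : GRing.comm (boost p q lam) rho.
  rewrite /GRing.comm -!mulmxE /rotation_part mulmxA boostM ?invr_eq0 //.
  by rewrite -mulmxA -boost_commute mulmxA boostM ?invr_eq0 // mulrC.
rewrite {1}boost_rotation mulmxE exprMn_comm //; congr (_ * _).
elim: k => [|k IH]; first by rewrite !expr0 boost1.
by rewrite exprS IH -mulmxE boostM ?expf_neq0 // exprS.
Qed.

Lemma lox_rotationE :
  h = rho + (lam - 1) *: light_proj p q + (lam^-1 - 1) *: light_proj q p.
Proof.
rewrite {1}boost_rotation; apply: eq_row_action => x.
rewrite mulmxA boostE !mulmxDl -!scalemxAl rotation_fixl rotation_fixr.
by rewrite !mulmxDr -!scalemxAr !light_projE !scalerA.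
Qed.

(** The isometry h and its rotation part differ only on the plane of p and q,
    where their eigenvalues are lam, 1/lam and 1, 1. Multiplying X - h and
    X - rho by suitable combinations of 1 and the two projections makes them
    equal over the polynomial ring; the determinants of these combinations are
    the two quadratic factors. *)
Lemma char_poly_lox :
  char_poly h * ('X - 1) ^+ 2 =
  char_poly rho * (('X - lam%:P) * ('X - lam^-1%:P)).
Proof.
pose Q1 := map_mx polyC (light_proj p q); pose Q2 := map_mx polyC (light_proj q p).
have rhoQ : map_mx polyC rho *m Q1 = Q1 /\ map_mx polyC rho *m Q2 = Q2.
  rewrite -!map_mxM; split; congr (map_mx _ _); apply: eq_row_action => x.
    by rewrite mulmxA !light_projE -{1}rotation_fixr bform_isometry // rotation_isometry.
  by rewrite mulmxA !light_projE -{1}rotation_fixl bform_isometry // rotation_isometry.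
have Q12 : Q1 *m Q2 = 0 by rewrite -map_mxM light_projMC map_mx0.
have detQ u v : \det (1%:M + u *: Q1 + v *: Q2) = (1 + u) * (1 + v).
  have -> : 1%:M + u *: Q1 + v *: Q2 = (1%:M + u *: Q1) *m (1%:M + v *: Q2).
    rewrite mulmxDl mul1mx mulmxDr mulmx1 -scalemxAr -scalemxAl Q12 !scaler0 addr0.
    by rewrite addrAC.
  have rank1 w a b : \det (1%:M + w *: map_mx polyC (light_proj a b)) = 1 + w * (bform S a b)%:P.
    rewrite /light_proj map_mxM scalemxAl det_add_rank1; congr (_ + _).
    by rewrite -scalemxAr mxE -map_mxM mxE mulmxA.
  by rewrite det_mulmx !rank1 pq1 qp1 !mulr1.
have QQ a b : bform S a b = 1 ->
    map_mx polyC (light_proj a b) *m map_mx polyC (light_proj a b) = map_mx polyC (light_proj a b).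
  move=> ab; rewrite -map_mxM; congr (map_mx _ _); apply: eq_row_action => x.
  by rewrite mulmxA !light_projE bformZl ab mulr1.
have Q11 : Q1 *m Q1 = Q1 by exact: QQ.
have Q22 : Q2 *m Q2 = Q2 by exact: QQ.
have Q21 : Q2 *m Q1 = 0.
  rewrite -map_mxM -[RHS](@map_mx0 _ _ polyC); congr (map_mx _ _); apply: eq_row_action => x.
  by rewrite mulmxA !light_projE bformZl qq mulr0 scale0r mulmx0.
have -> : ('X - 1) ^+ 2 = \det (1%:M + ('X - 2) *: Q1 + ('X - 2) *: Q2).
  by rewrite detQ; ring.
have -> : ('X - lam%:P) * ('X - lam^-1%:P) =
    \det (1%:M + ('X - lam%:P - 1) *: Q1 + ('X - lam^-1%:P - 1) *: Q2).
  by rewrite detQ; ring.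
rewrite /char_poly -!det_mulmx; congr (\det _); rewrite /char_poly_mx.
have -> : map_mx polyC h = map_mx polyC rho + (lam%:P - 1) *: Q1 + (lam^-1%:P - 1) *: Q2.
  by rewrite {1}lox_rotationE !map_mxD !map_mxZ /= !polyCB.
move: Q12 Q11 Q22 Q21 rhoQ.1 rhoQ.2; move: (map_mx polyC rho) (Q1) (Q2) => P A B AB AA BB BA PA PB.
rewrite !(mulmxDl, mulmxDr, mulmx1, mulNmx) -!scalemxAr -!scalemxAl.
rewrite !mul_scalar_mx PA PB AB AA BB BA !scaler0.
by apply/matrixP => i j; rewrite !mxE; ring.
Qed.
End Loxodromic.
End Pair.
End Boost.

(** * Compact isometries and recurrence *)

Section PositiveDefinite.
Variables (R : realFieldType) (n : nat) (T : 'M[R]_n.+1).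
Hypotheses (symT : T^T = T) (posT : forall x : 'rV_n.+1, x != 0 -> 0 < bform T x x).
Implicit Types x y : 'rV[R]_n.+1.

Lemma posdef_ge0 x : 0 <= bform T x x.
Proof. by have [->|/posT/ltW//] := eqVneq x 0; rewrite bform0l. Qed.

Lemma posdef_cauchy_schwarz x y :
  bform T x y ^+ 2 <= bform T x x * bform T y y.
Proof.
have [->|y0] := eqVneq y 0; first by rewrite !bform0r expr0n /= mulr0.
have h := posdef_ge0 (bform T y y *: x - bform T x y *: y).
rewrite !(bformDl, bformDr, bformNl, bformNr, bformZl, bformZr) (bformC y x symT) in h.
rewrite -subr_ge0 -(pmulr_rge0 _ (posT y0)); apply: le_trans h _.
by rewrite le_eqVlt; apply/orP; left; apply/eqP; ring.
Qed.

Lemma posdef_unit : T \in unitmx.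
Proof.
rewrite -row_free_unit; apply/row_freeP; rewrite -?unitmxE.
have : kermx T = 0.
  apply/eqP/rowV0P => x /sub_kermxP xT; apply/eqP; apply: contraT => /posT.
  by rewrite /bform xT mul0mx mxE ltxx.
by move/eqP; rewrite kermx_eq0 row_free_unit => Tu; exists (invmx T); rewrite mulmxV.
Qed.

(** Coordinate j of a vector is its T-product with a fixed vector t_j, and the
    rows of M^k have constant T-length: Cauchy-Schwarz bounds the entries. *)
Lemma isometry_powers_bounded (M : 'M[R]_n.+1) : M *m T *m M^T = T ->
  exists C, forall k i j, `|(M ^+ k) i j| <= C.
Proof.
move=> MT.
have MkT k : M ^+ k *m T *m (M ^+ k)^T = T.
  elim: k => [|k IH]; first by rewrite expr0 mul1mx trmx1 mulmx1.
  by rewrite exprS -mulmxE trmx_mul !mulmxA -(mulmxA M) -(mulmxA M) IH.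
pose e i : 'rV[R]_n.+1 := delta_mx 0 i.
pose t i := e i *m invmx T.
have tE x i : x 0 i = bform T x (t i).
  rewrite /bform /t trmx_mul trmx_inv symT mulmxA mulmxK ?posdef_unit //.
  by rewrite /e trmx_delta -colE mxE.
exists (1 + \sum_i \sum_j bform T (e i) (e i) * bform T (t j) (t j)) => k i j.
have sq : `|(M ^+ k) i j| ^+ 2 <= bform T (e i) (e i) * bform T (t j) (t j).
  have -> : (M ^+ k) i j = bform T (e i *m M ^+ k) (t j) by rewrite -tE -rowE mxE.
  rewrite real_normK ?num_real //; apply: le_trans (posdef_cauchy_schwarz _ _) _.
  by rewrite bform_isometry.
have le1 : `|(M ^+ k) i j| <= 1 + `|(M ^+ k) i j| ^+ 2.
  by have := sqr_ge0 (`|(M ^+ k) i j| - 1); rewrite sqrrB mulr1 expr1n; have := normr_ge0 ((M ^+ k) i j); lra.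
apply: le_trans le1 _; rewrite lerD2l; apply: le_trans sq _.
have ge0 i' j' : 0 <= bform T (e i') (e i') * bform T (t j') (t j') by rewrite mulr_ge0 ?posdef_ge0.
rewrite (bigD1 i) //= (bigD1 j) //= -addrA lerDl addr_ge0 ?sumr_ge0 // => i' _.
by rewrite sumr_ge0.
Qed.

End PositiveDefinite.

(** On the real and imaginary parts x, y of an eigenvector, T(x) + T(y) is both
    preserved and multiplied by |al|^2. *)
Lemma posdef_isometry_eigenvalue_norm1 (R : rcfType) (n : nat) (T M : 'M[R]_n.+1) (al : R[i]) :
  (forall x : 'rV_n.+1, x != 0 -> 0 < bform T x x) ->
  M *m T *m M^T = T ->
  root (char_poly (map_mx (real_complex R) M)) al -> `|al| = 1.
Proof.
move=> posT MT /real_eigenpair[x [y [xy0 xM yM]]].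
have pge0 z := posdef_ge0 posT z.
have := bform_isometry x x MT; have := bform_isometry y y MT.
rewrite xM yM !(bformDl, bformDr, bformNl, bformNr, bformZl, bformZr) => ey ex.
have e : (complex.Re al ^+ 2 + complex.Im al ^+ 2 - 1) * (bform T x x + bform T y y) = 0 by lra.
have pos : 0 < bform T x x + bform T y y.
  by case: xy0 => /posT p0; [rewrite ltr_pwDl|rewrite ltr_wpDl].
move/eqP: e; rewrite mulf_eq0 (gt_eqF pos) orbF subr_eq0 => /eqP e.
by rewrite normc_def e sqrtr1.
Qed.

(** Among the powers with exponent a multiple of K + 1, two lie in the same cell
    of a fine enough grid. Multiplying their difference by a bounded inverse
    power moves the closeness to the identity. *)
Lemma bounded_powers_recurrent (R : archiRealFieldType) (n : nat) (M : 'M[R]_n.+1) (C : R) :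
  M \in unitmx ->
  (forall k i j, `|(M ^+ k) i j| <= C) -> (forall k i j, `|(invmx M ^+ k) i j| <= C) ->
  forall (e : R) K, 0 < e -> exists2 k, (K <= k)%N & forall i j, `|(M ^+ k) i j - (1%:M : 'M[R]_n.+1) i j| <= e.
Proof.
move=> Mu MC MVC e K e0.
have C0 : 0 <= C := le_trans (normr_ge0 _) (MC 0%N 0 0).
pose B : R := n.+1%:R * C + 1.
have B0 : 0 < B by rewrite ltr_wpDl // mulr_ge0.
pose dl := e / B.
have dl0 : 0 < dl by rewrite divr_gt0.
pose L := (Num.truncn (2 * C / dl)).+1.
pose fl (x : R) : nat := Num.truncn ((x + C) / dl).
pose f (s : 'I_(L ^ (n.+1 * n.+1)).+1) : {ffun 'I_n.+1 * 'I_n.+1 -> 'I_L} :=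
  [ffun ij : 'I_n.+1 * 'I_n.+1 => inord (fl ((M ^+ (K.+1 * s)) ij.1 ij.2))].
have : ~ injective f.
  move=> inj; have := leq_card f inj.
  by rewrite card_ord card_ffun card_prod !card_ord ltnn.
move=> /existsNP[a] /existsNP[b] /not_implyP[fab /eqP nab].
wlog lt : a b fab nab / (a < b)%N.
  move=> H; case: (ltngtP a b) => ab; first exact: (H a b).
    by apply: (H b a) => //; rewrite eq_sym.
  by move: nab; rewrite -val_eqE /= ab eqxx.
have fl0 k i j : 0 <= ((M ^+ k) i j + C) / dl.
  by rewrite divr_ge0 ?(ltW dl0) //; have := MC k i j; rewrite ler_norml => /andP[]; lra.
have flL k i j : (fl ((M ^+ k) i j) < L)%N.
  rewrite ltnS; apply: le_truncn; rewrite ler_pM2r ?invr_gt0 //.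
  by have := MC k i j; rewrite ler_norml => /andP[]; lra.
have close i j : `|(M ^+ (K.+1 * b)) i j - (M ^+ (K.+1 * a)) i j| <= dl.
  have := congr1 (fun g : {ffun 'I_n.+1 * 'I_n.+1 -> 'I_L} => val (g (i, j))) fab.
  rewrite !ffunE /= !inordK // /fl => e1.
  have := truncn_itv (fl0 (K.+1 * b)%N i j); have := truncn_itv (fl0 (K.+1 * a)%N i j).
  rewrite e1; set m := Num.truncn _; set u := _ / _; set v := _ / _ => /andP[u1 u2] /andP[v1 v2].
  have -> : (M ^+ (K.+1 * b)) i j - (M ^+ (K.+1 * a)) i j = (v - u) * dl.
    by rewrite /u /v; field; rewrite gt_eqF.
  rewrite normrM (gtr0_norm dl0) ler_piMl ?(ltW dl0) // ler_norml.
  by rewrite -natr1 in u2 v2; apply/andP; split; lra.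
exists (K.+1 * (b - a))%N.
  by rewrite (leq_trans (leqnSn _)) // leq_pmulr // subn_gt0.
move=> i j.
have E : M ^+ (K.+1 * (b - a)) - 1%:M =
    invmx M ^+ (K.+1 * a) *m (M ^+ (K.+1 * b) - M ^+ (K.+1 * a)).
  have inv k : invmx M ^+ k *m M ^+ k = 1%:M.
    elim: k => [|k IH]; first by rewrite !expr0 mulmx1.
    by rewrite exprSr exprS -!mulmxE mulmxA -(mulmxA _ (invmx M)) mulVmx // mulmx1.
  rewrite mulmxBr inv mulnBr; congr (_ - _).
  rewrite -{2}(@subnK (K.+1 * a) (K.+1 * b)) ?leq_mul2l ?(ltnW lt) ?orbT //.
  by rewrite addnC exprD mulmxE mulrA [X in X * _](inv _) mul1r.
have -> : (M ^+ (K.+1 * (b - a))) i j - (1%:M : 'M[R]_n.+1) i j =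
   (M ^+ (K.+1 * (b - a)) - 1%:M) i j by rewrite !mxE.
rewrite E mxE; apply: le_trans (ler_norm_sum _ _ _) _.
apply: (@le_trans _ _ (\sum_(k < n.+1) C * dl)).
  apply: ler_sum => k _; rewrite normrM ler_pM //.
  by have := close k j; rewrite !mxE.
rewrite sumr_const card_ord -mulr_natl mulrA /dl mulrCA ler_piMr ?(ltW e0) //.
by rewrite ler_pdivrMr // mul1r /B lerDl.
Qed.

(** * Limits of matrices and recurrent families of polynomials *)

Lemma cvgn_sum (R : realType) (I : Type) (r : seq I) (f : I -> nat -> R) (l : I -> R) :
  (forall i, f i k @[k --> \oo] --> l i) ->
  (\sum_(i <- r) f i k) @[k --> \oo] --> \sum_(i <- r) l i.
Proof.
move=> fl; elim: r => [|i r IH].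
  by rewrite big_nil; under eq_fun do rewrite big_nil; exact: cvg_cst.
by rewrite big_cons; under eq_fun do rewrite big_cons; exact: cvgD.
Qed.

Lemma cvgn_prod (R : realType) (I : Type) (r : seq I) (f : I -> nat -> R) (l : I -> R) :
  (forall i, f i k @[k --> \oo] --> l i) ->
  (\prod_(i <- r) f i k) @[k --> \oo] --> \prod_(i <- r) l i.
Proof.
move=> fl; elim: r => [|i r IH].
  by rewrite big_nil; under eq_fun do rewrite big_nil; exact: cvg_cst.
by rewrite big_cons; under eq_fun do rewrite big_cons; exact: cvgM.
Qed.

Definition mx_cvg (R : realType) m n (u : nat -> 'M[R]_(m, n)) (l : 'M[R]_(m, n)) :=
  forall i j, u k i j @[k --> \oo] --> l i j.

Section MatrixLimits.
Variable R : realType.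

Lemma mx_cvg_cst m n (A : 'M[R]_(m, n)) : mx_cvg (fun=> A) A.
Proof. by move=> i j; exact: cvg_cst. Qed.

Lemma mx_cvgD m n (u v : nat -> 'M[R]_(m, n)) A B :
  mx_cvg u A -> mx_cvg v B -> mx_cvg (fun k => u k + v k) (A + B).
Proof. by move=> uA vB i j; rewrite mxE; under eq_fun do rewrite mxE; exact: cvgD. Qed.

Lemma mx_cvgZ m n (u : nat -> 'M[R]_(m, n)) A (c : nat -> R) (a : R) :
  c k @[k --> \oo] --> a -> mx_cvg u A -> mx_cvg (fun k => c k *: u k) (a *: A).
Proof. by move=> ca uA i j; rewrite mxE; under eq_fun do rewrite mxE; exact: cvgM. Qed.

Lemma mx_cvgM m n p (u : nat -> 'M[R]_(m, n)) (v : nat -> 'M[R]_(n, p)) A B :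
  mx_cvg u A -> mx_cvg v B -> mx_cvg (fun k => u k *m v k) (A *m B).
Proof.
move=> uA vB i j; rewrite mxE; under eq_fun do rewrite mxE.
by apply: cvgn_sum => h; exact: cvgM.
Qed.

Lemma mx_cvg_det n (u : nat -> 'M[R]_n) A :
  mx_cvg u A -> \det (u k) @[k --> \oo] --> \det A.
Proof.
move=> uA; rewrite /determinant; apply: cvgn_sum => s.
by apply: cvgM; [exact: cvg_cst|apply: cvgn_prod => i].
Qed.

End MatrixLimits.

(** Here kap lists return times: shifting the index of u by kap i brings every
    value back in the limit, coefficient by coefficient. The uniform bound on the
    degrees makes a descending induction on the degree possible. *)
Definition recurrent_family (R : realType) (kap : nat -> nat) (u : nat -> {poly R}) :=
  (exists D, forall k, (size (u k) <= D)%N) /\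
  forall m j, (u (m + kap i)%N)`_j @[i --> \oo] --> (u m)`_j.

Section RecurrentFamilies.
Variables (R : realType) (kap : nat -> nat).
Implicit Types u v : nat -> {poly R}.

Lemma recurrent_cst (c : {poly R}) : recurrent_family kap (fun=> c).
Proof. by split; [exists (size c)|move=> m j; exact: cvg_cst]. Qed.

Lemma recurrentD u v : recurrent_family kap u -> recurrent_family kap v ->
  recurrent_family kap (fun k => u k + v k).
Proof.
move=> [[D uD] ul] [[E vE] vl]; split.
  exists (maxn D E) => k; apply: leq_trans (size_polyD _ _) _.
  by rewrite geq_max !leq_max uD vE orbT.
by move=> m j; rewrite coefD; under eq_fun do rewrite coefD; exact: cvgD.
Qed.

Lemma recurrentM u v : recurrent_family kap u -> recurrent_family kap v ->
  recurrent_family kap (fun k => u k * v k).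
Proof.
move=> [[D uD] ul] [[E vE] vl]; split.
  exists (D + E)%N => k; apply: leq_trans (size_polyMleq _ _) _.
  by rewrite (leq_trans (leq_pred _)) // leq_add.
move=> m j; rewrite coefM; under eq_fun do rewrite coefM.
by apply: cvgn_sum => i; exact: cvgM.
Qed.

Lemma recurrent_sum (I : Type) (r : seq I) (F : I -> nat -> {poly R}) :
  (forall i, recurrent_family kap (F i)) ->
  recurrent_family kap (fun k => \sum_(i <- r) F i k).
Proof.
move=> rF; elim: r => [|i r IH].
  by under eq_fun do rewrite big_nil; exact: recurrent_cst.
by under eq_fun do rewrite big_cons; exact: recurrentD.
Qed.

Lemma recurrent_prod (I : Type) (r : seq I) (F : I -> nat -> {poly R}) :
  (forall i, recurrent_family kap (F i)) ->
  recurrent_family kap (fun k => \prod_(i <- r) F i k).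
Proof.
move=> rF; elim: r => [|i r IH].
  by under eq_fun do rewrite big_nil; exact: recurrent_cst.
by under eq_fun do rewrite big_cons; exact: recurrentM.
Qed.

Definition recurrent_mx m n (u : nat -> 'M[{poly R}]_(m, n)) :=
  forall i j, recurrent_family kap (fun k => u k i j).

Lemma recurrent_mx_cst m n (A : 'M[{poly R}]_(m, n)) : recurrent_mx (fun=> A).
Proof. by move=> i j; exact: recurrent_cst. Qed.

Lemma recurrent_mxD m n (u v : nat -> 'M[{poly R}]_(m, n)) :
  recurrent_mx u -> recurrent_mx v -> recurrent_mx (fun k => u k + v k).
Proof. by move=> ru rv i j; under eq_fun do rewrite mxE; exact: recurrentD. Qed.

Lemma recurrent_mxM m n p (u : nat -> 'M[{poly R}]_(m, n)) (v : nat -> 'M[{poly R}]_(n, p)) :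
  recurrent_mx u -> recurrent_mx v -> recurrent_mx (fun k => u k *m v k).
Proof.
move=> ru rv i j; under eq_fun do rewrite mxE.
by apply: recurrent_sum => h; exact: recurrentM.
Qed.

Lemma recurrent_mxX n (u : nat -> 'M[{poly R}]_n.+1) N :
  recurrent_mx u -> recurrent_mx (fun k => u k ^+ N).
Proof.
move=> ru; elim: N => [|N IH]; first by under eq_fun do rewrite expr0; exact: recurrent_mx_cst.
by under eq_fun do rewrite exprS; exact: recurrent_mxM.
Qed.

Lemma recurrent_det n (u : nat -> 'M[{poly R}]_n) :
  recurrent_mx u -> recurrent_family kap (fun k => \det (u k)).
Proof.
move=> ru; rewrite /determinant; apply: recurrent_sum => s.
by apply: recurrentM; [exact: recurrent_cst|apply: recurrent_prod => i].
Qed.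

(** Descending induction on the degree j. Suppose that the coefficients of degree
    above j vanish for every index. Dividing the equation at lam^k by lam^(j k)
    shows that the j-th coefficient of u_k tends to 0 as k grows; along the
    return times it tends to that of any given u_m, which is thus zero. *)
Lemma recurrent_family_eq0 u (lam : R) : recurrent_family kap u ->
  (forall i, (i <= kap i)%N) -> 1 < lam -> (forall k, (u k).[lam ^+ k] = 0) ->
  forall k, u k = 0.
Proof.
move=> [[D uD] ul] kapi lam1 u0.
have lam0 : 0 < lam by exact: lt_trans lam1.
suff H i : forall k j, (D - i <= j)%N -> (u k)`_j = 0.
  by move=> k; apply/polyP => j; rewrite coef0 (H D) // subnn.
elim: i => [|i IH] k j; first by rewrite subn0 => Dj; rewrite nth_default // (leq_trans (uD k)).
rewrite leq_eqVlt => /predU1P[jE|]; last by move=> lt; apply: IH; lia.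
have top k' j' : (j < j')%N -> (u k')`_j' = 0.
  by move=> jj'; apply: IH; lia.
have kinf : (k + kap i0)%N @[i0 --> \oo] --> \oo.
  apply/cvgnyPge => A; near=> i0; rewrite (leq_trans _ (leq_addl _ _)) // (leq_trans _ (kapi _)) //.
  near: i0; exact: nbhs_infty_ge.
have pow0 e : (0 < e)%N -> (lam^-1 ^+ e) ^+ (k + kap i0)%N @[i0 --> \oo] --> (0 : R).
  move=> e0; have := @cvg_geometric R 1 (lam^-1 ^+ e).
  rewrite ger0_norm ?exprn_ge0 ?invr_ge0 ?(ltW lam0) // exprn_ilt1 ?invr_ge0 ?(ltW lam0) ?invf_lt1 -?lt0n //.
  move=> /(_ e0) h.
  have -> : (fun i0 => (lam^-1 ^+ e) ^+ (k + kap i0)%N) =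
      geometric 1 (lam^-1 ^+ e) \o (fun i0 => k + kap i0)%N.
    by apply/funext => i0 /=; rewrite mul1r.
  exact: cvg_comp kinf h.
have lim0 : (u (k + kap i0)%N)`_j @[i0 --> \oo] --> (0 : R).
  have -> : (fun i0 => (u (k + kap i0)%N)`_j) = (fun i0 =>
      \sum_(h < j) - ((u (k + kap i0)%N)`_h * (lam^-1 ^+ (j - h)) ^+ (k + kap i0)%N)).
    apply/funext => i0; set k' := (k + kap i0)%N.
    have := u0 k'; rewrite (@horner_coef_wide _ j.+1); last first.
      by apply/leq_sizeP => j' jj'; exact: top.
    rewrite big_ord_recr /= => /eqP; rewrite addrC addr_eq0 => /eqP e.
    have l0 : (lam ^+ k') ^+ j != 0 by rewrite !expf_neq0 ?gt_eqF.
    apply: (mulIf l0); rewrite e mulr_suml -sumrN; apply: eq_bigr => h _.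
    rewrite mulNr -mulrA; congr (- (_ * _)).
    rewrite -!exprM.
    have -> : (k' * j = (j - h) * k' + k' * h)%N.
      by rewrite (mulnC (j - h)%N) -mulnDr subnK // ltnW.
    by rewrite exprD mulrA -exprMn mulVf ?expr1n ?mul1r // gt_eqF.
  rewrite [X in _ --> X](_ : _ = \sum_(h < j) 0); last by rewrite big1.
    apply: (@cvgn_sum R 'I_j _ (fun h i0 => - ((u (k + kap i0)%N)`_h * (lam^-1 ^+ (j - h)) ^+ (k + kap i0)%N)) (fun=> 0)) => h.
  rewrite [X in _ --> X](_ : _ = - ((u k)`_h * 0)); last by rewrite mulr0 oppr0.
  apply: cvgN.
  by apply: cvgM; [exact: ul|apply: pow0; rewrite subn_gt0].
exact: (cvg_unique _ (ul k j) lim0).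
Unshelve. all: by end_near.
Qed.

End RecurrentFamilies.

(** * From the powers of an isometry to its boosts *)

Lemma exists_return_times (R : realType) n (T M : 'M[R]_n.+1) :
  T^T = T -> (forall x : 'rV_n.+1, x != 0 -> 0 < bform T x x) ->
  M *m T *m M^T = T ->
  exists kap : nat -> nat, (forall i, (i <= kap i)%N) /\
    mx_cvg (fun i => M ^+ (kap i)) 1%:M.
Proof.
move=> symT posT MT; have Tu := posdef_unit posT.
have Mu := isometry_unitmx Tu MT.
have [C1 MC1] := isometry_powers_bounded symT posT MT.
have [C2 MC2] := isometry_powers_bounded symT posT (isometry_invmx Mu MT).
have /choice[kap kapP] : forall i : nat, exists k, (i <= k)%N /\
    forall a b, `|(M ^+ k) a b - (1%:M : 'M[R]_n.+1) a b| <= harmonic i.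
  have b1 k a b : `|(M ^+ k) a b| <= Num.max C1 C2 by rewrite le_max MC1.
  have b2 k a b : `|(invmx M ^+ k) a b| <= Num.max C1 C2 by rewrite le_max MC2 orbT.
  move=> i; have [k ik Mk] := bounded_powers_recurrent Mu b1 b2 i (harmonic_gt0 i).
  by exists k.
exists kap; split=> [i|a b]; first by case: (kapP i).
apply/cvgrPdist_le => e e0.
have /cvgrPdist_le/(_ e e0) := @cvg_harmonic R.
apply: filterS => i; rewrite sub0r normrN ger0_norm ?harmonic_ge0 // => h.
by rewrite distrC (le_trans _ h) //; case: (kapP i).
Qed.

(** The form T(x) = (x, p + q)^2 - (x, x) is invariant under every isometry fixing
    p + q, a vector of square 2. *)
Lemma fixed_pair_posdef (R : realFieldType) n (S : 'M[R]_n.+1) p q (rho : 'M[R]_n.+1) :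
  S^T = S -> lorentzian S -> hyperbolic_pair S p q ->
  rho *m S *m rho^T = S -> p *m rho = p -> q *m rho = q ->
  exists T : 'M[R]_n.+1, [/\ T^T = T, (forall x : 'rV_n.+1, x != 0 -> 0 < bform T x x) &
    rho *m T *m rho^T = T].
Proof.
move=> symS lorS [pp qq pq] rS pr qr; pose f := p + q.
have ff : bform S f f = 2.
  by rewrite !(bformDl, bformDr) pp qq (bformC q p symS) pq; ring.
have fr : f *m rho = f by rewrite mulmxDl pr qr.
exists (S *m f^T *m (S *m f^T)^T - S).
have TE x y : bform (S *m f^T *m (S *m f^T)^T - S) x y =
    bform S x f * bform S y f - bform S x y.
  rewrite /bform mulmxBr mulmxBl mxE [in X in _ + X]mxE; congr (_ - _).
  rewrite !mulmxA -(mulmxA _ _ y^T) -trmx_mul mulmxA [x *m S *m f^T]mx11_scalar.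
  by rewrite mul_scalar_mx !mxE eqxx mulr1n.
split.
- by rewrite linearB /= trmx_mul trmxK symS.
- by move=> x x0; rewrite TE -expr2 timelike_posdef.
- apply: bform_inj => x y.
  rewrite [RHS]TE -[in RHS](bform_isometry x f rS) -[in RHS](bform_isometry y f rS).
  rewrite -[in RHS](bform_isometry x y rS) fr -TE.
  by move: (_ - S) => T; rewrite /bform trmx_mul !mulmxA.
Qed.

Section Propagation.
Variables (R : realType) (n : nat) (S : 'M[R]_n.+1).
Hypotheses (symS : S^T = S) (lorS : lorentzian S).
Variables (p q : 'rV[R]_n.+1) (h : 'M[R]_n.+1) (lam : R).
Hypotheses (pq : hyperbolic_pair S p q) (hS : h *m S *m h^T = S) (lam1 : 1 < lam).
Hypotheses (ph : p *m h = lam *: p) (qh : q *m h = lam^-1 *: q).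

(** Replace the boost in h^k = boost(lam^k) rho^k by the one with a formal
    parameter X and clear denominators: the determinant becomes a polynomial u_k
    with u_k(lam^k) = 0. The rotation part rho has bounded powers, so (u_k) is
    recurrent and all the u_k vanish. At k = 0 this is the claim. *)
Lemma boost_propagation (N : nat) (A B : 'M[R]_n.+1) :
  (forall k, \det ((A *m h ^+ k *m B) ^+ N - 1%:M) = 0) ->
  forall z : R, z != 0 -> \det ((A *m boost S p q z *m B) ^+ N - 1%:M) = 0.
Proof.
move=> Hk z z0.
have lam0 : lam != 0 by rewrite gt_eqF // (lt_trans ltr01).
pose rho := rotation_part S p q h lam.
have [T [symT posT rT]] := fixed_pair_posdef symS lorS pq
  (rotation_isometry symS pq hS lam0) (rotation_fixl pq lam0 ph) (rotation_fixr symS pq lam0 qh).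
have [kap [kapi kapc]] := exists_return_times symT posT rT.
pose P1 := light_proj S p q; pose P2 := light_proj S q p.
pose W : 'M[{poly R}]_n.+1 := 'X *: map_mx polyC (1%:M - P1 - P2)
  + 'X ^+ 2 *: map_mx polyC P1 + map_mx polyC P2.
pose u k := \det ((map_mx polyC A *m W *m map_mx polyC (rho ^+ k) *m map_mx polyC B) ^+ N
   - ('X ^+ N)%:M).
have uE k w : w != 0 -> (u k).[w] =
    (w ^+ N) ^+ n.+1 * \det ((A *m boost S p q w *m rho ^+ k *m B) ^+ N - 1%:M).
  move=> w0; rewrite -detZ -horner_evalE -det_map_mx.
  have evC (M : 'M[R]_n.+1) : map_mx (horner_eval w) (map_mx polyC M) = M.
    by apply/matrixP => i j; rewrite !mxE /= horner_evalE hornerC.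
  have ev3 (Q0 Q1 Q2 : 'M[R]_n.+1) : map_mx (horner_eval w) ('X *: map_mx polyC Q0
      + 'X ^+ 2 *: map_mx polyC Q1 + map_mx polyC Q2) = w *: Q0 + w ^+ 2 *: Q1 + Q2.
    by rewrite !map_mxD !map_mxZ !evC /= !horner_evalE hornerXn hornerX.
  congr (\det _); rewrite map_mxB rmorphXn /= map_scalar_mx /= !map_mxM !evC.
  have -> : map_mx (horner_eval w) W = w *: boost S p q w.
    rewrite boost_scaled //; apply: ev3.
  rewrite horner_evalE hornerXn -scalemxAr -!scalemxAl exprZn scalerBr.
  by rewrite scale_scalar_mx mulr1.
have rec : recurrent_family kap u.
  apply: recurrent_det; apply: recurrent_mxD; last exact: recurrent_mx_cst.
  apply: recurrent_mxX; apply: recurrent_mxM; last exact: recurrent_mx_cst.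
  apply: recurrent_mxM; first exact: recurrent_mx_cst.
  move=> a b; split.
    by exists 1%N => k; rewrite mxE size_polyC leq_b1.
  have lim m : mx_cvg (fun i => rho ^+ (m + kap i)) (rho ^+ m).
    rewrite -[X in mx_cvg _ X]mulmx1; under eq_fun do rewrite exprD -mulmxE.
    by apply: mx_cvgM; [exact: mx_cvg_cst|].
  move=> m j; rewrite mxE coefC; under eq_fun do rewrite mxE coefC.
  by case: ifP => _; [exact: lim|exact: cvg_cst].
have u0 k : (u k).[lam ^+ k] = 0.
  rewrite uE ?expf_neq0 // -(mulmxA A) -(lox_powerE symS pq hS lam0 ph qh).
  by rewrite Hk mulr0.
have := congr1 (fun r : {poly R} => r.[z]) (recurrent_family_eq0 rec kapi lam1 u0 0%N).
rewrite uE // horner0 expr0 mulmx1 => /eqP; rewrite mulf_eq0 !expf_eq0 (negPf z0) !andbF /=.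
by move/eqP.
Qed.

End Propagation.

(** * The bivectors of the axes span all bivectors *)

Section PairSpan.
Variables (R : realFieldType) (n : nat) (S : 'M[R]_n.+1).
Hypotheses (symS : S^T = S) (lorS : lorentzian S).
Variables (p q : 'rV[R]_n.+1) (Gam : set 'M[R]_n.+1).
Hypothesis pq : hyperbolic_pair S p q.
Hypothesis GamS : forall y, Gam y -> y *m S *m y^T = S.
Hypothesis Gamu : forall y, Gam y -> y \in unitmx.
Hypothesis Gam1 : Gam 1%:M.
Hypothesis GamM : forall y z, Gam y -> Gam z -> Gam (y *m z).
Hypothesis GamV : forall y, Gam y -> Gam (invmx y).
Hypothesis Gamb : forall z, z != 0 -> Gam (boost S p q z).
Hypothesis irr : irreducible_on Gam.

(** The conjugates under Gam of the boosts along p and q are the boosts along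
    these pairs. *)
Definition axis a b :=
  exists2 y, Gam y & (a = p *m y /\ b = q *m y) \/ (a = q *m y /\ b = p *m y).

Lemma axisC a b : axis a b -> axis b a.
Proof. by case=> y Gy [[-> ->]|[-> ->]]; exists y => //; [right|left]. Qed.

Lemma axis_act a b u : Gam u -> axis a b -> axis (a *m u) (b *m u).
Proof.
move=> Gu [y Gy [[-> ->]|[-> ->]]]; exists (y *m u); rewrite ?mulmxA; try exact: GamM.
  by left.
by right.
Qed.

Lemma axis_pair a b : axis a b -> hyperbolic_pair S a b.
Proof.
have [pp qq pq1] := pq.
by case=> y /GamS yS [[-> ->]|[-> ->]]; split; rewrite bform_isometry // bformC.
Qed.

Lemma axis_boost a b z : axis a b -> z != 0 -> Gam (boost S a b z).
Proof.
have swap : boost S q p z = boost S p q z^-1.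
  by rewrite /boost invrK addrAC.
have conj y w : Gam y -> w != 0 -> Gam (boost S (p *m y) (q *m y) w).
  move=> Gy w0; rewrite -[boost _ _ _ _](mulKmx (Gamu Gy)) -boost_conj ?GamS //.
  by apply: GamM; [exact: GamV|apply: GamM => //; exact: Gamb].
case=> y Gy [[-> ->]|[-> ->]] z0; first exact: conj.
have -> : boost S (q *m y) (p *m y) z = boost S (p *m y) (q *m y) z^-1.
  by rewrite /boost invrK addrAC.
by apply: conj => //; rewrite invr_eq0.
Qed.

Definition null_on_axes (K : 'M[R]_n.+1) := K^T = - K /\ forall a b, axis a b -> bform K a b = 0.
(** By duality: the bivector of x and y is a linear combination of bivectors of
    axes. *)
Definition in_axis_span x y := forall K, null_on_axes K -> bform K x y = 0.

Lemma skewC (K : 'M[R]_n.+1) x y : K^T = - K -> bform K x y = - bform K y x.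
Proof. by move=> sk; rewrite -bform_trmx sk /bform mulmxN mulNmx mxE. Qed.

Lemma skew_diag (K : 'M[R]_n.+1) x : K^T = - K -> bform K x x = 0.
Proof. by move=> /(@skewC _ x x); lra. Qed.

Lemma in_axis_span_act x y u : Gam u -> in_axis_span x y -> in_axis_span (x *m u) (y *m u).
Proof.
move=> Gu nxy K [sk Kax].
have E a b : bform K (a *m u) (b *m u) = bform (u *m K *m u^T) a b.
  by rewrite /bform trmx_mul !mulmxA.
rewrite E; apply: nxy; split; first by rewrite !trmx_mul trmxK sk mulNmx mulmxN mulmxA.
by move=> a b ab; rewrite -E; apply/Kax/axis_act.
Qed.

(** The boosts along (a, a') act on the bivector of c and b with weights z, 1 and
    1/z. The parameters 2 and 1/2, together with 1, isolate the component of
    weight z, which is the bivector of a and (c,a') b - (b,a') c. *)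
Lemma in_axis_span_project a a' c b : axis a a' -> in_axis_span c b ->
  in_axis_span a (bform S c a' *: b - bform S b a' *: c).
Proof.
move=> ax ncb K KK; have [sk Kax] := KK.
have H z : z != 0 ->
    (z - 1) * (bform S b a' * bform K c a + bform S c a' * bform K a b)
  + (z^-1 - 1) * (bform S b a * bform K c a' + bform S c a * bform K a' b) = 0.
  move=> z0; have := in_axis_span_act (axis_boost ax z0) ncb KK.
  rewrite !boostE !(bformDl, bformDr, bformZl, bformZr) (ncb K KK) (Kax _ _ ax).
  by rewrite (Kax _ _ (axisC ax)) (skew_diag a sk) (skew_diag a' sk); lra.
have := H 2; have := H 2^-1; rewrite invrK invr_eq0 pnatr_eq0 => /(_ isT) h1 /(_ isT) h2.
by rewrite bformDr bformNr !bformZr (skewC a c sk); lra.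
Qed.

(** Projecting the bivector of b' and b along (a, a'), and the result along
    (b, b'), gives (a', b') times the bivector of a and b, up to a multiple of
    that of b and b'. *)
Lemma in_axis_span_of_opposite a a' b b' : axis a a' -> axis b b' ->
  bform S a' b' != 0 -> in_axis_span a b.
Proof.
move=> ax bx ab; have nb : in_axis_span b' b by move=> K [_ Kax]; exact: Kax (axisC bx).
have [bb bb' bb1] := axis_pair bx.
have n1 := in_axis_span_project ax nb.
have n2 := in_axis_span_project bx n1.
move=> K KK; have [sk Kax] := KK; have := n2 K KK.
rewrite !(bformDl, bformDr, bformNl, bformNr, bformZl, bformZr) (bformC b' a') //.
rewrite (Kax _ _ bx) (skew_diag b sk) bb1 bb' (skewC b a sk).
move=> e; have : bform S a' b' * bform K a b = 0 by lra.
by move/eqP; rewrite mulf_eq0 (negPf ab) => /eqP.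
Qed.

(** The previous lemma fails only if a' and b' are colinear. Then, unless a and b
    are colinear too, an axis (c, c') with no endpoint orthogonal to a' serves as
    an intermediary: the bivectors of a, c and of c, b are in the span, and
    projecting the latter along (a, a') gives that of a, b. *)
Lemma axis_endpoints_in_span a a' b b' : axis a a' -> axis b b' -> in_axis_span a b.
Proof.
move=> ax bx.
have [ab'0|] := eqVneq (bform S a' b') 0; last exact: in_axis_span_of_opposite ax bx.
have [aa a'a' aa1] := axis_pair ax; have [bb b'b' bb1] := axis_pair bx.
have nz u v : hyperbolic_pair S u v -> u != 0.
  by case=> _ _ uv; apply: contraTneq (oner_neq0 R) => u0; rewrite -uv u0 bform0l eqxx.
have a0 := nz _ _ (axis_pair ax); have a'0 := nz _ _ (axis_pair (axisC ax)).
have [ab0|ab0] := eqVneq (bform S a b) 0.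
  have [c ->] : exists c, b = c *: a.
    by apply: (nonneg_orthogonal_colinear symS lorS) => //; rewrite ?aa ?bb.
  by move=> K [sk _]; rewrite bformZr skew_diag // mulr0.
have [k bE] : exists k, b' = k *: a'.
  by apply: (nonneg_orthogonal_colinear symS lorS) => //; rewrite ?a'a' ?b'b'.
have k0 : k != 0.
  by apply: contraTneq (oner_neq0 R) => k0; rewrite -bb1 bE k0 scale0r bform0r eqxx.
have [u Gu a'u] : exists2 u, Gam u & bform S (a' *m u) a' != 0.
  apply: contrapT => nou.
  have st y : Gam y -> forall v, v \in <[a']>%VS -> v *m y \in <[a']>%VS.
    move=> Gy v /vlineP[w ->]; rewrite -scalemxAl memvZ //; apply/vlineP.
    apply: (nonneg_orthogonal_colinear symS lorS) => //; rewrite ?a'a' ?bform_isometry ?GamS ?a'a' //.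
    rewrite bformC //; apply/eqP; apply: contraT => ne.
    by case: nou; exists y.
  case: (irr st) => [/eqP|full]; first by rewrite -dimv_eq0 dim_vline a'0.
  have /vlineP[w aE] : a \in <[a']>%VS by rewrite full memvf.
  by move: aa1 => /eqP; rewrite aE bformZl a'a' mulr0 eq_sym oner_eq0.
(* Since u moves the line of a', the translate (a u, a' u) is such an axis unless
   a u falls on the line of a'; then b u does not, and (b u, b' u) is one. *)
have [c [c' [cx ca' c'a']]] : exists c c', [/\ axis c c', bform S c a' != 0 & bform S c' a' != 0].
  have [au0|au0] := eqVneq (bform S (a *m u) a') 0; last first.
    by exists (a *m u), (a' *m u); split=> //; exact: axis_act.
  exists (b *m u), (b' *m u); split; first exact: axis_act.
    have [m auE] : exists m, a *m u = m *: a'.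
      apply: (nonneg_orthogonal_colinear symS lorS) => //; rewrite ?a'a' ?bform_isometry ?GamS ?aa //.
      by rewrite bformC.
    apply: contraNneq ab0 => bu0; rewrite bformC // -(bform_isometry b a (GamS Gu)).
    by rewrite auE bformZr bu0 mulr0.
  by rewrite bE -scalemxAl bformZl mulf_neq0.
have nac : in_axis_span a c by apply: in_axis_span_of_opposite ax cx _; rewrite bformC.
have ncb : in_axis_span c b by apply: in_axis_span_of_opposite cx bx _; rewrite bE bformZr mulf_neq0.
move=> K KK; have := in_axis_span_project ax ncb KK.
rewrite bformDr bformNr !bformZr (nac K KK) mulr0 subr0 => /eqP.
by rewrite mulf_eq0 (negPf ca') => /eqP.
Qed.

(** The endpoints of the axes form a Gam-stable family, so they span the space by
    irreducibility; a form null on all pairs of endpoints is zero. *)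
Lemma null_on_axes_eq0 (K : 'M[R]_n.+1) : null_on_axes K -> K = 0.
Proof.
move=> KK; pose X : set 'rV[R]_n.+1 := [set a | exists a', axis a a'].
have [pp qq pq1] := pq.
have axpq : axis p q by exists 1%:M => //; left; rewrite !mulmx1.
have p0 : p != 0 by apply: contraTneq (oner_neq0 R) => p0; rewrite -pq1 p0 bform0l eqxx.
have stX y v : Gam y -> X v -> X (v *m y).
  by move=> Gy [v' vv]; exists (v' *m y); exact: axis_act.
have [s [sX full]] := irreducible_spanning irr stX (ex_intro _ q axpq : X p) p0.
have K0 x y : bform K x y = 0.
  have Ks b x' : X b -> bform K x' b = 0.
    move=> [b' bb]; have : x' \in << s >>%VS by rewrite full memvf.
    move: x'; apply: span_ind.
    - exact: bform0l.
    - by move=> ? ?; rewrite bformDl => -> ->; rewrite addr0.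
    - by move=> ? ?; rewrite bformZl => ->; rewrite mulr0.
    - by move=> a /sX[a' aa]; exact: axis_endpoints_in_span aa bb K KK.
  have : y \in << s >>%VS by rewrite full memvf.
  move: y; apply: span_ind.
  - exact: bform0r.
  - by move=> ? ?; rewrite bformDr => -> ->; rewrite addr0.
  - by move=> ? ?; rewrite bformZr => ->; rewrite mulr0.
  - by move=> b /sX; exact: Ks.
by apply: bform_inj => x y; rewrite K0 /bform mulmx0 mul0mx mxE.
Qed.

End PairSpan.

Definition bivector (R : pzRingType) n (a b : 'rV[R]_n) : 'M[R]_n := b^T *m a - a^T *m b.

Section Bivectors.
Variables (R : realFieldType) (n : nat) (S : 'M[R]_n.+1).
Variables (p q : 'rV[R]_n.+1) (Gam : set 'M[R]_n.+1).
Hypothesis null_on_axes0 : forall K, null_on_axes p q Gam K -> K = 0.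

(** An induction principle saying that the bivectors of the axes span the skew
    matrices. A linear functional that kills them is given by a matrix F whose
    skew part is null on the axes, hence zero; and a symmetric F kills every skew
    J. *)
Lemma skew_ind_axis_bivectors (P : 'M[R]_n.+1 -> Prop) (J : 'M[R]_n.+1) :
  P 0 -> (forall x y, P x -> P y -> P (x + y)) -> (forall c x, P x -> P (c *: x)) ->
  (forall a b, axis p q Gam a b -> P (bivector a b)) -> J^T = - J -> P J.
Proof.
move=> P0 PD PZ Pax skJ.
have [s [sX Xs]] := exists_finite_spanning_seq
  [set M : 'M[R]_n.+1 | exists a b, axis p q Gam a b /\ M = bivector a b].
suff Js : J \in << s >>%VS.
  by apply: (span_ind P0 PD PZ _ Js) => M /sX[a [b [ab ->]]]; exact: Pax.
apply: contraT => nJs.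
pose U := << s >>%VS; pose phi (M : 'M[R]_n.+1) := M - projv U M.
have phiJ : phi J != 0.
  apply: contra nJs; rewrite subr_eq0 => /eqP ->; exact: memv_proj.
have [i [j ij]] : exists i j, phi J i j != 0.
  apply: contrapT => no; move/eqP: phiJ; apply; apply/matrixP => i j.
  rewrite [RHS]mxE; apply/eqP; apply: contraT => ne.
  by case: no; exists i, j.
pose f (M : 'M[R]_n.+1) := phi M i j.
have fD M M' : f (M + M') = f M + f M'.
  by rewrite /f /phi linearD /= opprD addrACA mxE.
have fZ c M : f (c *: M) = c * f M.
  by rewrite /f /phi linearZ /= -scalerBr mxE.
have f0 : f 0 = 0 by rewrite -(scale0r 0) fZ mul0r.
have fU M : M \in U -> f M = 0 by move=> MU; rewrite /f /phi projv_id // subrr mxE.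
pose F : 'M[R]_n.+1 := \matrix_(a, b) f (delta_mx a b).
have fE M : f M = \sum_a \sum_b M a b * F a b.
  rewrite {1}(matrix_sum_delta M) (big_morph f fD f0); apply: eq_bigr => a _.
  by rewrite (big_morph f fD f0); apply: eq_bigr => b _; rewrite fZ mxE.
have fxy (x y : 'rV[R]_n.+1) : f (x^T *m y) = bform F x y.
  rewrite fE /bform mxE exchange_big /=; apply: eq_bigr => b _; rewrite mxE mulr_suml.
  by apply: eq_bigr => a _; rewrite !mxE big_ord1 !mxE mulrAC.
have K0 : F^T - F = 0.
  apply: null_on_axes0; split; first by rewrite linearB /= trmxK opprB.
  move=> a b ab.
  have -> : bform (F^T - F) a b = bform F b a - bform F a b.
    by rewrite -(bform_trmx F a b) /bform mulmxBr mulmxBl mxE [in X in _ + X = _]mxE.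
  rewrite -!fxy -[- f _]mulN1r -fZ -fD scaleN1r; apply: fU.
  by apply: Xs; exists a, b.
have Fsym a b : F a b = F b a.
  by move/eqP: K0; rewrite subr_eq0 => /eqP/matrixP/(_ b a); rewrite mxE.
have : f J = - f J.
  rewrite -mulN1r -fZ scaleN1r -skJ !fE exchange_big /=.
  by apply: eq_bigr => a _; apply: eq_bigr => b _; rewrite [J^T _ _]mxE Fsym.
by move=> e; move/eqP: ij; case; rewrite -/(f J); lra.
Qed.

End Bivectors.

(** * Tangent vectors at the identity *)

Section Tangent.
Variables (R : realType) (n : nat) (S : 'M[R]_n.+1) (Gam : set 'M[R]_n.+1).
Hypothesis Gam1 : Gam 1%:M.
Hypothesis GamM : forall y z, Gam y -> Gam z -> Gam (y *m z).

(** With h_k = 1/(k+1) this says g_k = 1 + h_k X + o(h_k). Fixed step sizes h_k let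
    the velocities of products add up. *)
Definition velocity (g : nat -> 'M[R]_n.+1) X :=
  mx_cvg (fun k => (harmonic k)^-1 *: (g k - 1%:M)) X.

Lemma velocity1 : velocity (fun=> 1%:M) 0.
Proof.
rewrite /velocity; under eq_fun do rewrite subrr scaler0; exact: mx_cvg_cst.
Qed.

Lemma velocityM g g' X X' : velocity g X -> velocity g' X' ->
  velocity (fun k => g k *m g' k) (X + X').
Proof.
move=> gX gX'; have g1 : mx_cvg g' 1%:M.
  have -> : g' = fun k => 1%:M + harmonic k *: ((harmonic k)^-1 *: (g' k - 1%:M)).
    apply/funext => k; rewrite scalerA mulfV ?scale1r ?gt_eqF ?harmonic_gt0 //.
    by rewrite addrC subrK.
  rewrite -[X in mx_cvg _ X]addr0 -(scale0r X').
  apply: mx_cvgD; first exact: mx_cvg_cst.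
  by apply: mx_cvgZ => //; exact: cvg_harmonic.
rewrite /velocity -[X in X + _]mulmx1.
have -> : (fun k => (harmonic k)^-1 *: (g k *m g' k - 1%:M)) = (fun k =>
    ((harmonic k)^-1 *: (g k - 1%:M)) *m g' k + (harmonic k)^-1 *: (g' k - 1%:M)).
  apply/funext => k; rewrite -scalemxAl -scalerDr mulmxBl mul1mx.
  by rewrite addrA subrK.
by apply: mx_cvgD => //; exact: mx_cvgM.
Qed.

Lemma velocityX g X N : velocity g X -> velocity (fun k => g k ^+ N) (N%:R *: X).
Proof.
move=> gX; elim: N => [|N IH].
  by rewrite scale0r; under eq_fun do rewrite expr0; exact: velocity1.
rewrite -natr1 scalerDl scale1r; under eq_fun do rewrite exprSr.
exact: velocityM.
Qed.

(** Asking for all the multiples c X makes the tangent vectors a linear subspace. *)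
Definition tangent X :=
  forall c : R, exists2 g, (forall k, Gam (g k)) & velocity g (c *: X).

Lemma tangent0 : tangent 0.
Proof. by move=> c; exists (fun=> 1%:M) => //; rewrite scaler0; exact: velocity1. Qed.

Lemma tangentD X Y : tangent X -> tangent Y -> tangent (X + Y).
Proof.
move=> tX tY c; have [g Gg gX] := tX c; have [g' Gg' gY] := tY c.
exists (fun k => g k *m g' k); first by move=> k; exact: GamM.
by rewrite scalerDr; exact: velocityM.
Qed.

Lemma tangentZ c X : tangent X -> tangent (c *: X).
Proof. by move=> tX d; rewrite scalerA; exact: tX. Qed.

Lemma tangent_boost a b : (forall z, z != 0 -> Gam (boost S a b z)) ->
  tangent (S *m bivector a b).
Proof.
(* The quadratic term keeps z k away from 0 without changing the first order. *)
move=> Gab c; pose z k := 1 + c * harmonic k + (c * harmonic k) ^+ 2 : R.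
have z0 k : z k != 0.
  rewrite gt_eqF // (_ : z k = (1 + c * harmonic k / 2) ^+ 2 + 3 / 4 * (c * harmonic k) ^+ 2); last first.
    by rewrite /z; field.
  have [e|ne] := eqVneq (c * harmonic k) 0.
    by rewrite e mul0r addr0 !expr0n expr1n mulr0 addr0 ltr01.
  by rewrite ltr_wpDl ?sqr_ge0 // mulr_gt0 // ?divr_gt0 // lt_neqAle sqr_ge0 andbT eq_sym sqrf_eq0.
exists (fun k => boost S a b (z k)); first by move=> k; exact: Gab.
have hc : harmonic k @[k --> \oo] --> (0 : R) by exact: cvg_harmonic.
have zc : z k @[k --> \oo] --> (1 : R).
  rewrite [X in _ --> X](_ : _ = 1 + c * 0 + (c * 0) * (c * 0)); last by rewrite mulr0 mulr0 !addr0.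
  have ch : c * harmonic k @[k --> \oo] --> c * 0 by apply: cvgM => //; exact: cvg_cst.
  under eq_fun do rewrite /z expr2.
  by apply: cvgD; [apply: cvgD => //; exact: cvg_cst|apply: cvgM].
have vc : (harmonic k)^-1 * (z k - 1) @[k --> \oo] --> c.
  have -> : (fun k => (harmonic k)^-1 * (z k - 1)) = (fun k => c + c ^+ 2 * harmonic k).
    apply/funext => k; rewrite /z; field; by rewrite gt_eqF ?harmonic_gt0.
  rewrite -[X in _ --> X]addr0 -(mulr0 (c ^+ 2)).
  by apply: cvgD; [exact: cvg_cst|apply: cvgM => //; exact: cvg_cst].
have wc : (harmonic k)^-1 * ((z k)^-1 - 1) @[k --> \oo] --> - c.
  have -> : (fun k => (harmonic k)^-1 * ((z k)^-1 - 1)) =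
      (fun k => - ((harmonic k)^-1 * (z k - 1)) * (z k)^-1).
    apply/funext => k; field; by rewrite z0 gt_eqF ?harmonic_gt0.
  rewrite -[X in _ --> X]mulr1 -[X in _ * X]invr1.
  by apply: cvgM; [exact: cvgN|apply: cvgV => //; exact: oner_neq0].
rewrite /velocity.
have -> : (fun k => (harmonic k)^-1 *: (boost S a b (z k) - 1%:M)) = (fun k =>
   ((harmonic k)^-1 * (z k - 1)) *: light_proj S a b +
   ((harmonic k)^-1 * ((z k)^-1 - 1)) *: light_proj S b a).
  apply/funext => k; rewrite /boost addrAC (addrAC 1%:M) subrr add0r.
  by rewrite scalerDr !scalerA.
have -> : c *: (S *m bivector a b) = c *: light_proj S a b + (- c) *: light_proj S b a.
  by rewrite /light_proj /bivector mulmxBr scaleNr scalerBr !mulmxA.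
by apply: mx_cvgD; apply: mx_cvgZ => //; exact: mx_cvg_cst.
Qed.

(** Along a sequence of velocity X the quotients (y^N - 1) / h_k tend to N X,
    whose determinant is not zero. *)
Lemma tangent_unit_det_neq0 X N : (0 < N)%N -> X \in unitmx -> tangent X ->
  exists2 y, Gam y & \det (y ^+ N - 1%:M) != 0.
Proof.
move=> N0 Xu /(_ 1)[g Gg]; rewrite scale1r => gX.
apply: contrapT => no.
have d0 k : \det (g k ^+ N - 1%:M) = 0.
  by apply/eqP; apply: contraT => ne; case: no; exists (g k).
have dc := mx_cvg_det (velocityX (N := N) gX).
have : (fun k => \det ((harmonic k)^-1 *: (g k ^+ N - 1%:M))) = (fun=> 0).
  by apply/funext => k; rewrite detZ d0 mulr0.
move=> e; rewrite e in dc.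
have zc : (fun _ : nat => 0 : R) x @[x --> \oo] --> (0 : R) by exact: cvg_cst.
have /eqP : \det (N%:R *: X) = 0 by exact: (cvg_unique _ dc zc).
rewrite detZ mulf_eq0 expf_eq0 pnatr_eq0 (gtn_eqF N0) andbF /=.
by rewrite -[_ == 0]negbK -unitfE -unitmxE Xu.
Qed.

End Tangent.

(** * The positive cone and the signature *)

Lemma form_continuous (R : realType) n (S : 'M[R]_n) (a : 'rV[R]_n) :
  continuous (fun x : 'rV[R]_n => bform S a x).
Proof.
have -> : (fun x : 'rV[R]_n => bform S a x) = (fun x => \sum_j (a *m S) 0 j * x 0 j).
  by apply/funext => x; rewrite /bform mxE; apply: eq_bigr => j _; rewrite [x^T _ _]mxE.
elim: (index_enum _) => [|j r IH].
  have -> : (fun x : 'rV[R]_n => \sum_(j <- [::]) (a *m S) 0 j * x 0 j) = (fun=> 0).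
    by apply/funext => x; rewrite big_nil.
  by move=> x; exact: cst_continuous.
have -> : (fun x : 'rV[R]_n => \sum_(i <- j :: r) (a *m S) 0 i * x 0 i) =
    (fun x => (a *m S) 0 j * x 0 j + \sum_(i <- r) (a *m S) 0 i * x 0 i).
  by apply/funext => x; rewrite big_cons.
move=> x.
have cj : (fun y : 'rV[R]_n => (a *m S) 0 j * y 0 j) @ x --> (a *m S) 0 j * x 0 j.
  exact: (cvgM (cvg_cst _) (@coord_continuous R 1 n 0 j x)).
exact: cvgD cj (IH x).
Qed.

(** No positive vector is orthogonal to a, so the continuous function (a, -) keeps
    its sign on a connected set of positive vectors. *)
Lemma component_same_sign (R : realType) n (S : 'M[R]_n) (x0 a x y : 'rV[R]_n) :
  let pos := [set z | 0 < bform S z z] in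
  S^T = S -> lorentzian S -> a != 0 -> 0 <= bform S a a ->
  connected_component pos x0 x -> connected_component pos x0 y ->
  0 < bform S a x * bform S a y.
Proof.
move=> pos symS lorS a0 aa Cx Cy; set C := connected_component pos x0 in Cx Cy.
have cC : connected (bform S a @` C).
  apply: connected_continuous_connected; first exact: component_connected.
  by apply: continuous_subspaceT; exact: form_continuous.
have n0 z : C z -> bform S a z != 0.
  move=> /connected_component_sub pz; apply/eqP => az.
  have := timelike_orthogonal_neg symS lorS pz _ a0; rewrite bformC // az => /(_ erefl).
  by rewrite ltNge aa.
have Ix : (bform S a @` C) (bform S a x) by exists x.
have Iy : (bform S a @` C) (bform S a y) by exists y.
have itv := (connected_intervalP _).1 cC.
have no u v : (bform S a @` C) u -> (bform S a @` C) v -> u < 0 -> 0 < v -> False.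
  move=> Iu Iv u0 v0; have uv : u <= 0 <= v by rewrite !ltW.
  have [z Cz /eqP] := itv u v Iu Iv 0 uv.
    by rewrite (negPf (n0 z Cz)).
have nx := n0 x Cx; have ny := n0 y Cy.
case: (ltgtP (bform S a x) 0) nx => // hx _; case: (ltgtP (bform S a y) 0) ny => // hy _.
- by rewrite nmulr_rgt0.
- by case: (no _ _ Ix Iy hx hy).
- by case: (no _ _ Iy Ix hy hx).
- by rewrite mulr_gt0.
Qed.

(** The negative definite hyperplane consists of the vectors whose first
    coordinate in the diagonalizing basis vanishes. *)
Lemma signature_lorentzian (R : realType) t (S : 'M[R]_(1 + t)) :
  has_signature S -> lorentzian S /\ S \in unitmx.
Proof.
move=> [P Pu PS]; set J := block_mx _ _ _ _ in PS; split; last first.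
  have : P *m S *m P^T \in unitmx.
    by rewrite PS unitmxE det_ublock det1 mul1r -scaleN1r detZ det1 mulr1 unitrX // unitrN1.
  by rewrite !unitmx_mul unitmx_tr => /andP[/andP[]].
exists (invmx P *m delta_mx 0 0) => z zl z0; pose w := z *m invmx P.
have wP : w *m P = z by rewrite mulmxKV.
have w0 : w != 0 by apply: contraNneq z0 => w0; rewrite -wP w0 mul0mx.
have wl : lsubmx w = 0.
  apply/matrixP => i j; rewrite !ord1 !mxE.
  have := congr1 (fun M : 'M[R]_(1, 1) => M 0 0) zl.
  rewrite mulmxA -colE !mxE => e; apply: etrans e; apply: eq_bigr => k _.
  by congr (_ * invmx P _ _); apply/val_inj.
have -> : bform S z z = - ((rsubmx w *m (rsubmx w)^T) 0 0).
  rewrite /bform -wP trmx_mul !mulmxA -(mulmxA w) -(mulmxA w) PS.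
  rewrite -[w]hsubmxK wl row_mxKr /J mul_row_block tr_row_mx mul_row_col.
  by rewrite !mul0mx mulmx0 !add0r mulmxN mulmx1 mulNmx mul0mx add0r mxE.
rewrite oppr_lt0 mxE lt_neqAle; apply/andP; split; last first.
  by apply: sumr_ge0 => k _; rewrite [trmx _ _ _]mxE -expr2 sqr_ge0.
rewrite eq_sym psumr_eq0; last by move=> k _; rewrite [trmx _ _ _]mxE -expr2 sqr_ge0.
apply: contra w0 => /allP w0; rewrite -[w]hsubmxK wl.
suff -> : rsubmx w = 0 by rewrite row_mx0.
apply/matrixP => i k; rewrite (ord1 i) [RHS]mxE; apply/eqP.
by have := w0 k (mem_index_enum _); rewrite /= [trmx _ _ _]mxE -expr2 sqrf_eq0.
Qed.

(** * An element with an expanding eigenvalue *)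

Lemma injective_finite_list (T : eqType) (F : finType) (G : set T) (f : T -> F) :
  (forall g g', G g -> G g' -> f g = f g' -> g = g') ->
  exists s : seq T, uniq s /\ forall g, g \in s <-> G g.
Proof.
move=> inj.
pose h (y : F) : option T := match pselect (exists g, G g /\ f g = y) with
  | left e => Some (projT1 (cid e)) | right _ => None end.
exists (undup (pmap h (enum F))); split; first exact: undup_uniq.
move=> g; rewrite mem_undup mem_pmap; split.
  move=> /mapP[y _]; rewrite /h; case: pselect => // e [->].
  by case: (projT2 (cid e)).
move=> Gg; apply/mapP; exists (f g); first by rewrite mem_enum.
rewrite /h; case: pselect => [e|]; last by case; exists g.
by case: (cid e) => g' /= [Gg' /esym]; move=> /(inj _ _ Gg Gg') ->.
Qed.

Section TraceForm.
Variables (R : rcfType) (n : nat) (Gam : set 'M[R]_n.+1).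
Hypothesis irr : irreducible_on Gam.
Hypothesis GamM : forall y z, Gam y -> Gam z -> Gam (y *m z).
Hypothesis Gam1 : Gam 1%:M.
Variable s : seq 'M[R]_n.+1.
Hypothesis sG : forall y, y \in s -> Gam y.
Hypothesis Gs : forall y, Gam y -> y \in << s >>%VS.

Lemma span_group_mul a b : a \in << s >>%VS -> b \in << s >>%VS -> a *m b \in << s >>%VS.
Proof.
move=> aA; move: b; apply: span_ind => [|b c|k b|b bs].
- by rewrite mulmx0 mem0v.
- by move=> ba ca; rewrite mulmxDr memvD.
- by move=> ba; rewrite -scalemxAr memvZ.
move: a aA; apply: span_ind => [|b' c|k b'|b' bs'].
- by rewrite mul0mx mem0v.
- by move=> ba ca; rewrite mulmxDl memvD.
- by move=> ba; rewrite -scalemxAl memvZ.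
by apply: Gs; apply: GamM; exact: sG.
Qed.

(** Suppose that x a is not zero. By irreducibility x a b = x for some b in the
    algebra spanned by s, so c = a b has the eigenvalue 1. But all the traces of
    the powers of c vanish, so c has no eigenvalue other than 0. *)
Lemma trace_form_nondegenerate a : a \in << s >>%VS ->
  (forall u, u \in s -> \tr (a *m u) = 0) -> a = 0.
Proof.
move=> aA tra.
have trA b : b \in << s >>%VS -> \tr (a *m b) = 0.
  move: b; apply: span_ind => [|b c|k b|//].
  - by rewrite mulmx0 mxtrace0.
  - by move=> e1 e2; rewrite mulmxDr mxtraceD e1 e2 addr0.
  - by move=> e; rewrite -scalemxAr mxtraceZ e mulr0.
apply/eqP; apply: contraT => a0.
have [x xa] : exists x : 'rV[R]_n.+1, x *m a != 0.
  apply: contrapT => no; move/eqP: a0; apply; apply: eq_row_action => x.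
  rewrite mulmx0; apply/eqP; apply: contraT => ne; by case: no; exists x.
pose V := << [seq x *m a *m u | u <- s] >>%VS.
have VA b : b \in << s >>%VS -> x *m a *m b \in V.
  move: b; apply: span_ind => [|b c|k b|b bs].
  - by rewrite mulmx0 mem0v.
  - by move=> h1 h2; rewrite mulmxDr memvD.
  - by move=> h1; rewrite -scalemxAr memvZ.
  - by apply: memv_span; apply: map_f.
have AV v : v \in V -> exists2 b, b \in << s >>%VS & v = x *m a *m b.
  move: v; apply: span_ind => [|u w [b bA ->] [c cA ->]|k u [b bA ->]|u].
  - by exists 0; rewrite ?mem0v ?mulmx0.
  - by exists (b + c); rewrite ?memvD ?mulmxDr.
  - by exists (k *: b); rewrite ?memvZ // scalemxAr.
  - by move=> /mapP[b bs ->]; exists b => //; exact: memv_span.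
have xaV : x *m a \in V by have := VA _ (Gs Gam1); rewrite mulmx1.
have {}irrV := irr (V := V).
case: irrV => [y Gy v /AV[b bA ->]|V0|Vfull].
- by have := VA _ (span_group_mul bA (Gs Gy)); rewrite mulmxA.
- by rewrite V0 memv0 (negPf xa) in xaV.
have [b bA xE] : exists2 b, b \in << s >>%VS & x = x *m a *m b.
  by apply: AV; rewrite Vfull memvf.
pose c := a *m b; pose toC := real_complex R.
have cA : c \in << s >>%VS by exact: span_group_mul.
have trc j : \tr (c ^+ j.+1) = 0.
  rewrite exprS -mulmxE -mulmxA; apply: trA; apply: span_group_mul => //.
  elim: j => [|j IH]; first by rewrite expr0; exact: Gs.
  by rewrite exprS -mulmxE; exact: span_group_mul.
have [r [rE rT]] := exists_eigenvalue_tuple (map_mx toC c).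
have r0 i : r i = 0.
  apply: (@power_sums_eq0 _ _ r id) => j _.
  under eq_bigr do rewrite -exprSr.
  by rewrite -rT -rmorphXn /= trace_map_mx trc rmorph0.
have x0 : x != 0 by apply: contraNneq xa => ->; rewrite mul0mx.
have : root (char_poly (map_mx toC c)) 1.
  rewrite -eigenvalue_root_char; apply/eigenvalueP; exists (map_mx toC x).
    by rewrite scale1r -map_mxM mulmxA -xE.
  by rewrite map_mx_eq0.
rewrite rE -(big_map r predT (fun z => 'X - z%:P)) root_prod_XsubC => /mapP[i _].
by rewrite r0 => /eqP; rewrite oner_eq0.
Qed.

End TraceForm.

Lemma map_realmxC (R : realType) m n (g : 'M[int]_(m, n)) :
  map_mx (real_complex R) (realmx R g) = map_mx intr g.
Proof. by apply/matrixP => i j; rewrite !mxE rmorph_int. Qed.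

Lemma realmx_inj (R : realType) m n : injective (@realmx R m n).
Proof.
move=> g g' /matrixP e; apply/matrixP => i j; have := e i j.
by rewrite !mxE => /intr_inj.
Qed.

Lemma realmxM (R : realType) m n p (g : 'M[int]_(m, n)) (h : 'M[int]_(n, p)) :
  realmx R (g *m h) = realmx R g *m realmx R h.
Proof. exact: map_mxM. Qed.

Lemma int_trace_bound (R : realType) n (g : 'M[int]_n.+1) :
  (forall z : R[i], root (map_poly intr (char_poly g)) z -> `|z| <= 1) ->
  (`|\tr g| <= n.+1)%N.
Proof.
move=> g1.
have [r [rE rT]] := exists_eigenvalue_tuple (map_mx (intr : int -> R[i]) g).
rewrite -map_char_poly -(big_map r predT (fun z => 'X - z%:P)) in rE.
have r1 i : `|r i| <= 1.
  by apply: g1; rewrite rE root_prod_XsubC; apply: map_f; rewrite mem_index_enum.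
rewrite -lez_nat abszE -(ler_int R[i]) intr_norm.
have := rT 1%N; rewrite expr1 trace_map_mx => ->.
apply: le_trans (ler_norm_sum _ _ _) _.
rewrite -pmulrn -[n.+1 in leRHS]card_ord -sum1_card natr_sum.
by apply: ler_sum => i _; rewrite expr1.
Qed.

(** Otherwise the traces of the elements of G are integers bounded by the rank.
    As the trace form is nondegenerate on the span of G, an element is determined
    by its traces against finitely many others, so G is finite. The sum of the
    orbit of x0 is then a fixed vector, not zero because of the positivity
    assumption, and it spans a stable line. *)
Lemma exists_expanding_element (R : realType) n (S : 'M[R]_n.+1) (G : set 'M[int]_n.+1)
    (x0 : 'rV[R]_n.+1) :
  (0 < n)%N -> irreducible_on [set realmx R g | g in G] ->
  G 1%:M -> (forall g h, G g -> G h -> G (g *m h)) ->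
  (forall g, G g -> g \in unitmx) ->
  (forall g, G g -> 0 < bform S x0 (x0 *m realmx R g)) ->
  exists2 g, G g & exists2 z : R[i], root (map_poly intr (char_poly g)) z & 1 < `|z|.
Proof.
move=> n0 irr G1 GM Gu pos; apply: contrapT => no.
have tr1 g : G g -> (`|\tr g| <= n.+1)%N.
  move=> Gg; apply: (@int_trace_bound R) => z gz; rewrite real_leNgt ?normr_real ?real1 //.
  by apply/negP => z1; apply: no; exists g => //; exists z.
pose Gam := [set realmx R g | g in G].
have GamM y z : Gam y -> Gam z -> Gam (y *m z).
  by move=> [g Gg <-] [h Gh <-]; exists (g *m h); rewrite ?realmxM //; exact: GM.
have Gam1 : Gam 1%:M by exists 1%:M => //; rewrite /realmx map_mx1.
have [s [sX Xs]] := exists_finite_spanning_seq Gam.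
have /choice[pre preP] : forall v, exists g, v \in s -> G g /\ realmx R g = v.
  move=> v; have [vs|] := boolP (v \in s); last by exists 1%:M.
  by have [g Gg gv] := sX v vs; exists g.
pose f (g : 'M[int]_n.+1) : {ffun 'I_(size s) -> 'I_(n.+1.*2.+1)} :=
  [ffun i : 'I_(size s) => inord (absz (\tr (g *m pre s`_i) + n.+1%:Z)%R)].
have finj g g' : G g -> G g' -> f g = f g' -> g = g'.
  move=> Gg Gg' fgg; apply: (@realmx_inj R); apply/eqP; rewrite -subr_eq0; apply/eqP.
  apply: (trace_form_nondegenerate irr GamM Gam1 sX Xs).
    by rewrite memvB // Xs //; [exists g|exists g'].
  move=> u us; have iu : (index u s < size s)%N by rewrite index_mem.
  have [Gp pu] := preP u us.
  have := congr1 (fun F : {ffun 'I_(size s) -> 'I_(n.+1.*2.+1)} => val (F (Ordinal iu))) fgg.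
  have b1 := tr1 _ (GM _ _ Gg Gp); have b2 := tr1 _ (GM _ _ Gg' Gp).
  have bd (a : int) : (`|a| <= n.+1)%N -> (absz (a + n.+1%:Z)%R < n.+1.*2.+1)%N by lia.
  rewrite !ffunE /= nth_index // !inordK ?bd // => e.
  have {}e : \tr (g *m pre u) = \tr (g' *m pre u).
    move: b1 b2 e; move: (\tr (g *m pre u)) (\tr (g' *m pre u)) => a b; lia.
  by rewrite mulmxBl raddfB /= -pu -!realmxM !trace_map_mx e subrr.
have [L [uL LG]] := injective_finite_list finj.
pose v := \sum_(g <- L) x0 *m realmx R g.
have vfix u : G u -> v *m realmx R u = v.
  move=> Gx; rewrite /v mulmx_suml [RHS](perm_big [seq g *m u | g <- L]) /=; last first.
    have inj : injective (fun g : 'M[int]_n.+1 => g *m u) by exact: can_inj (mulmxK (Gu _ Gx)).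
    have uM : uniq [seq g *m u | g <- L] by rewrite map_inj_uniq.
    have sub : {subset [seq g *m u | g <- L] <= L}.
      by move=> ? /mapP[g /LG Gg ->]; apply/LG; exact: GM.
    have [_ eqi] := uniq_min_size uM sub (eq_leq (esym (size_map _ _))).
    by rewrite perm_sym uniq_perm.
  by rewrite big_map; apply: eq_bigr => g _; rewrite realmxM mulmxA.
have vpos : 0 < bform S x0 v.
  rewrite bform_sumr (bigD1_seq 1%:M) //=; last by apply/LG.
  rewrite ltr_pwDl ?pos // big_seq_cond; apply: sumr_ge0 => g /andP[gL _].
  by apply/ltW/pos/LG.
have st y : Gam y -> forall w, w \in <[v]>%VS -> w *m y \in <[v]>%VS.
  by move=> [u Gx <-] w /vlineP[k ->]; rewrite -scalemxAl vfix // memvZ ?memv_line.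
case: (irr _ st) => [v0|full].
  have : v \in <[v]>%VS by exact: memv_line.
  by rewrite v0 memv0 => /eqP v00; move: vpos; rewrite v00 bform0r ltxx.
have := congr1 (fun V : {vspace _} => \dim V) full.
rewrite dim_vline dimvf /dim /= mul1n.
by case: (v != 0) => /= e; move: n0; rewrite -ltnS -e.
Qed.

(** The hypothesis relating x0 and x0 g expresses that g preserves the positive
    cone; it forces lam > 0. The contracting vector q comes from an eigenvector w
    of the transpose of g through S^-1, which intertwines g with its inverse
    transpose. *)
Lemma loxodromic_data (R : realType) n (S g : 'M[R]_n.+1) (z : R[i]) x0 :
  S^T = S -> lorentzian S -> S \in unitmx -> g *m S *m g^T = S ->
  (forall a, a != 0 -> 0 <= bform S a a -> 0 < bform S a x0 * bform S a (x0 *m g)) ->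
  root (char_poly (map_mx (real_complex R) g)) z -> 1 < `|z| ->
  exists lam p q, [/\ 1 < lam, z = lam%:C%C, hyperbolic_pair S p q,
    p *m g = lam *: p & q *m g = lam^-1 *: q].
Proof.
move=> symS lorS Su gS sgn gz z1.
have [x [y [xy0 xg yg]]] := real_eigenpair gz.
set a := complex.Re z in xg yg; set b := complex.Im z in xg yg.
have ab1 : 1 < a ^+ 2 + b ^+ 2.
  move: z1; rewrite normc_def -/a -/b ltcR => z1.
  by rewrite -ltr_sqrt ?sqrtr1 // ltNge; apply: contraL z1 => h; rewrite -leNgt (le_trans (ler_wsqrtr h)) ?sqrtr0.
have [b0 [p p0 pg]] := isometry_eigenpair_real symS lorS gS xy0 xg yg ab1.
have a21 : a ^+ 2 != 1 by rewrite gt_eqF //; move: ab1; rewrite b0 expr0n addr0.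
have pp := isometry_eigen_isotropic gS pg a21.
have a1 : 1 < a.
  have := sgn p p0; rewrite pp lexx => /(_ isT).
  rewrite -{1}(bform_isometry p x0 gS) pg bformZl -mulrA -expr2 => h.
  have a0 : 0 < a.
    rewrite ltNge; apply: contraL h => an; rewrite -leNgt mulr_le0_ge0 // sqr_ge0 //.
  by move: ab1; rewrite b0 expr0n addr0 expr_gt1 // ltW.
have a0 : a != 0 by rewrite gt_eqF // (lt_trans ltr01).
have [w w0 wg] : exists2 w : 'rV[R]_n.+1, w != 0 & w *m g^T = a *: w.
  have : eigenvalue g^T a.
    have : eigenvalue g a by apply/eigenvalueP; exists p.
    rewrite !eigenvalue_root_char; congr (root _ a).
    rewrite /char_poly -det_tr; congr (\det _).
    by rewrite /char_poly_mx linearB /= tr_scalar_mx map_trmx.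
  by move=> /eigenvalueP[w wg w0]; exists w.
pose q := w *m invmx S.
have q0 : q != 0 by apply: contraNneq w0 => q0; rewrite -(mulmxKV Su w) -/q q0 mul0mx.
have qg : q *m g = a^-1 *: q.
  have e : w = a^-1 *: (w *m g^T) by rewrite wg scalerA mulVf // scale1r.
  have e2 : g^T *m invmx S *m g = invmx S.
    have gu := isometry_unitmx Su gS.
    apply: (can_inj (mulKmx Su)); rewrite mulmxV //.
    apply: (can_inj (mulKmx gu)); rewrite mulmx1 !mulmxA gS.
    by rewrite mulmxV // mul1mx.
  by rewrite {1}/q {1}e -!scalemxAl -!mulmxA (mulmxA g^T) e2.
have a'21 : a^-1 ^+ 2 != 1 by rewrite exprVn invr_eq1.
have qq := isometry_eigen_isotropic gS qg a'21.
have pq0 : bform S p q != 0.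
  apply/eqP => pq; have [c qE] : exists c, q = c *: p.
    by apply: (nonneg_orthogonal_colinear symS lorS); rewrite ?pp ?qq.
  have c0 : c != 0 by apply: contraNneq q0 => c0; rewrite qE c0 scale0r.
  move: qg; rewrite qE -scalemxAl pg !scalerA => /eqP.
  rewrite -subr_eq0 -scalerBl scaler_eq0 (negPf p0) orbF mulrC -mulrBl mulf_eq0 (negPf c0) orbF.
  rewrite subr_eq0 => /eqP e; move/eqP: a21; apply.
  by rewrite expr2 {2}e mulfV.
exists a, p, ((bform S p q)^-1 *: q); split=> //.
- by rewrite /a; case: z @a @b {gz z1 xg yg ab1 pg a21 a1 a0 wg qg a'21} b0 => ? ? /= ->.
- by split; rewrite ?bformZl ?bformZr ?pp ?qq ?mulr0 // mulVf.
- by rewrite -scalemxAl qg !scalerA mulrC.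
Qed.

(** * Salem polynomials *)

Lemma monic_prod_roots (C : closedFieldType) (p : {poly C}) :
  p \is monic -> exists rs, p = \prod_(z <- rs) ('X - z%:P).
Proof.
move=> /monicP mon; have [rs e] := closed_field_poly_normal p.
by exists rs; rewrite {1}e mon scale1r.
Qed.

Lemma nonreal_conj_pairs (R : rcfType) (s : seq R[i]) :
  perm_eq (map conjc s) s -> (forall z, z \in s -> complex.Im z != 0) ->
  exists A, perm_eq s (A ++ map conjc A) /\ {subset A <= s}.
Proof.
move=> sJ sIm; pose up (z : R[i]) := 0 < complex.Im z.
exists [seq z <- s | up z]; split; last by move=> z; rewrite mem_filter => /andP[].
rewrite -(perm_filterC up s) perm_cat2l.
rewrite perm_sym; apply: (@perm_trans _ [seq z <- map conjc s | predC up z]); last exact: seq.perm_filter.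
rewrite filter_map (@eq_in_filter _ (preim conjc (predC up)) up s) // => z zs.
have := sIm z zs; rewrite /= /up; case: z {zs} => a b /= b0.
by rewrite oppr_gt0 -leNgt le_eqVlt eq_sym (negPf b0).
Qed.

Lemma monic_irreducible_int (p : {poly int}) : p \is monic -> (1 < size p)%N ->
  (forall q r, q \is monic -> r \is monic -> p = q * r -> size q = 1%N \/ size r = 1%N) ->
  irreducible_int_poly p.
Proof.
move=> mon sp H; split.
- exact: monic_neq0.
- by rewrite poly_unitE; case: eqP sp => // ->.
move=> q r pqr; have lqr : lead_coef q * lead_coef r = 1.
  by rewrite -lead_coefM -pqr; apply/monicP.
have lrq : lead_coef r * lead_coef q = 1 by rewrite mulrC.
have q'mon : lead_coef r *: q \is monic by rewrite monicE lead_coefZ lrq.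
have r'mon : lead_coef q *: r \is monic by rewrite monicE lead_coefZ lqr.
have pE : p = (lead_coef r *: q) * (lead_coef q *: r).
  by rewrite -scalerAl -scalerAr scalerA lrq scale1r.
have unitl (u v : {poly int}) : lead_coef u * lead_coef v = 1 -> size (lead_coef v *: u) = 1%N ->
    u \is a GRing.unit.
  move=> luv su; have lv0 : lead_coef v != 0.
    by apply: contraTneq (oner_neq0 int) => lv0; rewrite -luv lv0 mulr0 eqxx.
  rewrite size_scale // in su.
  rewrite poly_unitE su eqxx /=; have -> : u`_0 = lead_coef u by rewrite lead_coefE su.
  by apply/unitrP; exists (lead_coef v); rewrite luv mulrC luv.
by case: (H _ _ q'mon r'mon pE) => s1; [left|right]; [exact: unitl lqr s1|exact: unitl lrq s1].
Qed.

Section Salem.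
Variables (R : realType) (n d N : nat) (S : 'M[R]_n.+1) (g : 'M[int]_n.+1) (x0 : 'rV[R]_n.+1).
Hypothesis nd : n.+1 = (2 * d)%N.
Hypothesis kro : forall q : {poly int}, q \is monic -> (size q <= n.+2)%N ->
    (forall z : R[i], root (map_poly intr q) z -> `|z| <= 1) ->
    forall z : R[i], root (map_poly intr q) z -> z != 0 -> z ^+ N = 1.
Hypotheses (symS : S^T = S) (lorS : lorentzian S) (Su : S \in unitmx).
Hypothesis gS : realmx R g *m S *m (realmx R g)^T = S.
Hypothesis sgn : forall a, a != 0 -> 0 <= bform S a a ->
  0 < bform S a x0 * bform S a (x0 *m realmx R g).
Hypothesis detg : \det g = 1.
Hypothesis detN : \det (realmx R g ^+ N - 1%:M) != 0.

Let chi : {poly R[i]} := map_poly intr (char_poly g).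

Let chiE : chi = char_poly (map_mx (real_complex R) (realmx R g)).
Proof. by rewrite map_realmxC /chi map_char_poly. Qed.

Let chi_monic : chi \is monic.
Proof. by rewrite chiE char_poly_monic. Qed.

Let size_chi : size chi = n.+2.
Proof. by rewrite chiE size_char_poly. Qed.

Let size_chi_int : size (char_poly g) = n.+2.
Proof. exact: size_char_poly. Qed.

Lemma eigen_not_root_of_unity z : root chi z -> z ^+ N != 1.
Proof.
rewrite chiE -eigenvalue_root_char => /eigenvalueP[v vg v0]; apply: contra detN => /eqP zN.
set M := map_mx _ _ in vg.
have vgk k : v *m M ^+ k = z ^+ k *: v.
  elim: k => [|k IH]; first by rewrite !expr0 mulmx1 scale1r.
  by rewrite exprSr -mulmxE mulmxA IH -scalemxAl vg scalerA -exprSr.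
have : \det (M ^+ N - 1%:M) == 0.
  by apply/det0P; exists v => //; rewrite mulmxBr vgk zN scale1r mulmx1 subrr.
have -> : M ^+ N - 1%:M = map_mx (real_complex R) (realmx R g ^+ N - 1%:M).
  by rewrite map_mxB map_mx1 rmorphXn.
by rewrite det_map_mx fmorph_eq0.
Qed.

Lemma eigen_neq0 z : root chi z -> z != 0.
Proof.
apply: contraTneq => ->; rewrite /root horner_coef0 coef_map char_poly_det detg mulr1 /=.
by rewrite intr_eq0 signr_eq0.
Qed.

(** Otherwise all its roots are in the closed unit disc, and Kronecker's theorem
    makes them roots of unity of order dividing N. *)
Lemma factor_has_large_root (q : {poly int}) : q \is monic -> (size q <= n.+2)%N -> size q != 1%N ->
  (forall z : R[i], root (map_poly intr q) z -> root chi z) ->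
  exists2 z : R[i], root (map_poly intr q) z & 1 < `|z|.
Proof.
move=> mon sq q1 qchi; apply: contrapT => no.
have [z qz] : exists z : R[i], root (map_poly intr q) z.
  apply/closed_rootP; rewrite size_map_poly_id0 //.
  by rewrite (monicP mon) rmorph1 oner_neq0.
have : z ^+ N = 1.
  apply: (kro mon sq) => // [w qw|]; last by apply: eigen_neq0; exact: qchi.
  by rewrite real_leNgt ?normr_real ?real1 //; apply/negP => w1; apply: no; exists w.
by move/eqP; rewrite (negPf (eigen_not_root_of_unity (qchi _ qz))).
Qed.

Let chi_root1 : ~~ root chi 1.
Proof. by apply/negP => /eigen_not_root_of_unity; rewrite expr1n eqxx. Qed.

Let chi_rootN1 : ~~ root chi (-1).
Proof.
(* The factor X + 1 has no large root. *)
apply/negP => r1.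
have [z] : exists2 z : R[i], root (map_poly intr ('X - (-1)%:P)) z & 1 < `|z|.
  apply: factor_has_large_root; rewrite ?monicXsubC ?size_XsubC //.
  by move=> z; rewrite map_polyXsubC root_XsubC /= rmorphN1 => /eqP ->.
by rewrite map_polyXsubC root_XsubC /= rmorphN1 => /eqP ->; rewrite normrN1 ltxx.
Qed.

(** The rotation part of g preserves a definite form, so its eigenvalues have
    modulus 1, and char_poly_lox compares the two spectra with multiplicities. *)
Lemma salem_spectrum : exists (lam : R) (rs : seq R[i]),
  [/\ 1 < lam, chi = \prod_(z <- lam%:C%C :: (lam^-1)%:C%C :: rs) ('X - z%:P) &
   forall z, z \in rs -> `|z| = 1].
Proof.
have [z chiz z1] : exists2 z : R[i], root chi z & 1 < `|z|.
  by apply: (factor_has_large_root (char_poly_monic g)); rewrite ?size_chi_int.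
have [lam [p [q [lam1 zE pq pg qg]]]] : exists lam p q, [/\ 1 < lam, z = lam%:C%C, hyperbolic_pair S p q,
    p *m realmx R g = lam *: p & q *m realmx R g = lam^-1 *: q].
  by apply: (loxodromic_data symS lorS Su gS sgn _ z1); rewrite -chiE.
have lam0 : lam != 0 by rewrite gt_eqF // (lt_trans ltr01).
pose rho := rotation_part S p q (realmx R g) lam.
have [T [symT posT rT]] := fixed_pair_posdef symS lorS pq
  (rotation_isometry symS pq gS lam0) (rotation_fixl pq lam0 pg) (rotation_fixr symS pq lam0 qg).
have := char_poly_lox symS pq gS lam0 pg qg => /(congr1 (map_poly (real_complex R))).
rewrite [LHS]rmorphM /= [RHS]rmorphM /= rmorphXn /= [X in _ = _ * X]rmorphM /=.
rewrite !rmorphB /= !map_polyX !map_polyC /= rmorph1 !map_char_poly -chiE.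
have [rs rsE] := monic_prod_roots chi_monic.
have [us usE] := monic_prod_roots (char_poly_monic (map_mx (real_complex R) rho)).
rewrite -/rho rsE usE => e.
have {}e : perm_eq (rs ++ [:: 1; 1]) (us ++ [:: lam%:C%C; (lam^-1)%:C%C]).
  by apply: prod_XsubC_eq; rewrite !big_cat !big_cons !big_nil /= !mulr1 -polyC1 -expr2.
have us1 w : w \in us -> `|w| = 1.
  move=> wu; apply: (posdef_isometry_eigenvalue_norm1 posT rT).
  by rewrite -/rho usE root_prod_XsubC.
have inrs (w : R) : 1 != w -> w%:C%C \in us ++ [:: lam%:C%C; (lam^-1)%:C%C] -> w%:C%C \in rs.
  move=> w1; rewrite -(perm_mem e) mem_cat !inE orbb => /orP[//|].
  by move/eqP => /(congr1 (@complex.Re R)) /= w1'; rewrite w1' eqxx in w1.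
have lamrs : lam%:C%C \in rs.
  by apply: inrs; rewrite ?mem_cat ?inE ?eqxx ?orbT // lt_eqF.
have lamV : lam^-1 < 1 by rewrite invf_lt1 // (lt_trans ltr01).
have lamVrs : (lam^-1)%:C%C \in rem lam%:C%C rs.
  have : (lam^-1)%:C%C \in rs by apply: inrs; rewrite ?mem_cat ?inE ?eqxx ?orbT // gt_eqF.
  rewrite (perm_mem (perm_to_rem lamrs)) inE => /predU1P[/(congr1 (@complex.Re R)) /= ll|//].
  by move: (lt_trans lamV lam1); rewrite ll ltxx.
pose rs2 := rem (lam^-1)%:C%C (rem lam%:C%C rs).
have rsP : perm_eq rs [:: lam%:C%C, (lam^-1)%:C%C & rs2].
  by apply: perm_trans (perm_to_rem lamrs) _; rewrite perm_cons; exact: perm_to_rem.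
exists lam, rs2; split=> //.
  exact: perm_big.
move=> w wrs.
have e2 : perm_eq (rs2 ++ [:: 1; 1]) us.
  rewrite -(perm_cat2r [:: lam%:C%C; (lam^-1)%:C%C]); apply: perm_trans e.
  rewrite perm_catAC perm_cat2r perm_catC perm_sym.
  exact: rsP.
by apply: us1; rewrite -(perm_mem e2) mem_cat wrs.
Qed.

(** Each of two nontrivial monic factors would have a root outside the closed unit
    disc, but lam is the only such root of chi and it is simple. The remaining
    roots are on the unit circle and differ from 1 and -1, so they are not real
    and group into conjugate pairs. *)
Lemma salem_char_poly : salem_polynomial R d (char_poly g).
Proof.
have [lam [rs [lam1 chiP rs1]]] := salem_spectrum.
have lam0 : 0 < lam by exact: lt_trans lam1.
have d0 : (0 < d)%N by case: d nd => //; rewrite muln0.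
have chi_mem z : root chi z = (z \in [:: lam%:C%C, (lam^-1)%:C%C & rs]).
  by rewrite chiP root_prod_XsubC.
split=> //.
- by rewrite size_chi_int nd.
- exact: char_poly_monic.
- apply: monic_irreducible_int; rewrite ?char_poly_monic ?size_chi_int //.
  have large z : root chi z -> 1 < `|z| -> z = lam%:C%C.
    rewrite chi_mem !inE => /or3P[/eqP//|/eqP ->|/rs1 ->]; last by rewrite ltxx.
    rewrite normc_def /= expr0n addr0 sqrtr_sqr ltcR ger0_norm ?invr_ge0 ?ltW //.
    by rewrite ltNge ltW // invf_lt1.
  move=> q r qm rm qr.
  have chiqr : chi = map_poly intr q * map_poly intr r by rewrite /chi qr rmorphM.
  have sz (u v : {poly int}) : u \is monic -> v \is monic -> char_poly g = u * v -> (size u <= n.+2)%N.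
    move=> um vm uv; rewrite -size_chi_int uv size_Mmonic ?monic_neq0 //.
    have : (0 < size v)%N by rewrite size_poly_gt0 monic_neq0.
    by case: (size v) => // k _; rewrite addnS leq_addr.
  have [q1|q1] := eqVneq (size q) 1%N; first by left.
  have [r1|r1] := eqVneq (size r) 1%N; first by right.
  have [z qz z1] := factor_has_large_root qm (sz _ _ qm rm qr) q1
    (fun z qz => eq_ind_r (fun c => root c z) (etrans (rootM _ _ _) (introT orP (or_introl qz))) chiqr).
  have [w rw w1] := factor_has_large_root rm (sz r q rm qm (etrans qr (mulrC _ _))) r1
    (fun z rz => eq_ind_r (fun c => root c z) (etrans (rootM _ _ _) (introT orP (or_intror rz))) chiqr).
  have zE : z = lam%:C%C by apply: large => //; rewrite chiqr rootM qz.
  have wE : w = lam%:C%C by apply: large => //; rewrite chiqr rootM rw orbT.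
  have monC (u : {poly int}) : u \is monic -> (map_poly intr u : {poly R[i]}) \is monic.
    by move=> um; rewrite monicE lead_coef_map_eq (monicP um) ?rmorph1 ?oner_neq0 //.
  have [qs qsE] := monic_prod_roots (monC _ qm); have [ss ssE] := monic_prod_roots (monC _ rm).
  have pe : perm_eq (qs ++ ss) [:: lam%:C%C, (lam^-1)%:C%C & rs].
    by apply: prod_XsubC_eq; rewrite big_cat /= -qsE -ssE -chiqr chiP.
  rewrite qsE zE root_prod_XsubC in qz; rewrite ssE wE root_prod_XsubC in rw.
  have : perm_eq (lam%:C%C :: rem lam%:C%C qs ++ lam%:C%C :: rem lam%:C%C ss) [:: lam%:C%C, (lam^-1)%:C%C & rs].
    by apply: perm_trans pe; rewrite perm_sym -cat_cons; apply: perm_cat; exact: perm_to_rem.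
  rewrite perm_cons => /perm_mem/(_ lam%:C%C).
  rewrite mem_cat !inE eqxx orbT => /esym/orP[|/rs1].
    move=> /eqP/(congr1 (@complex.Re R)) /= ll.
    have lamV : lam^-1 < 1 by rewrite invf_lt1.
    by move: (lt_trans lamV lam1); rewrite -ll ltxx.
  rewrite normc_def /= expr0n addr0 sqrtr_sqr => /(congr1 (@complex.Re R)) /=.
  by rewrite gtr0_norm // => l1; rewrite l1 ltxx in lam1.
have chiJ : map_poly conjc chi = chi.
  rewrite /chi -map_poly_comp; apply: eq_map_poly => m /=; exact: rmorph_int.
have rsJ : perm_eq (map conjc rs) rs.
  have : perm_eq (map conjc [:: lam%:C%C, (lam^-1)%:C%C & rs]) [:: lam%:C%C, (lam^-1)%:C%C & rs].
    by apply: prod_XsubC_eq; rewrite -[RHS]chiP -chiJ chiP map_prod_XsubC big_map.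
  by rewrite /= !oppr0 !perm_cons.
have rsIm z : z \in rs -> complex.Im z != 0.
  move=> zrs; have zn := rs1 z zrs.
  have zr : root chi z by rewrite chi_mem !inE zrs !orbT.
  apply/negP => /eqP; case: z zn zr {zrs} => a b /= zn zr b0; rewrite b0 in zn zr.
  move: zn; rewrite normc_def /= expr0n addr0 sqrtr_sqr => /(congr1 (@complex.Re R)) /= /eqP.
  rewrite eqr_norml ler01 andbT => /orP[/eqP|/eqP] aE; rewrite aE in zr.
    by move: chi_root1; rewrite zr.
  by move: chi_rootN1; have <- : (-1 +i* 0)%C = -1 :> R[i]; rewrite ?zr //; apply/eqP; rewrite eq_complex /= oppr0 !eqxx.
have [A [rsA Ars]] := nonreal_conj_pairs rsJ rsIm.
have sizeA : size A = d.-1.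
  have s1 : (size rs).+2 = n.+1.
    by have := size_chi; rewrite chiP size_prod_XsubC /=; lia.
  have := perm_size rsA; rewrite size_cat size_map => s2.
  move: s2 s1 nd; move: (size rs) (size A) => a b; lia.
exists lam, (fun i => nth 0 A i); split=> //.
  move=> i; have iA : nth 0 A i \in A by rewrite mem_nth // sizeA.
  have irs := Ars _ iA; have ichi : root chi (nth 0 A i) by rewrite chi_mem !inE irs !orbT.
  by split; [exact: rs1|apply: contraTneq ichi => ->|apply: contraTneq ichi => ->].
rewrite -/chi chiP !big_cons mulrA; congr (_ * _).
rewrite (perm_big _ rsA) big_cat big_map /= -big_split /=.
by rewrite (big_nth 0) sizeA big_mkord.
Qed.

End Salem.

(** * An element without eigenvalues that are roots of unity *)

Lemma exists_skew_unit (R : realFieldType) (m d : nat) : m = (2 * d)%N ->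
  exists2 J : 'M[R]_m, J^T = - J & J \in unitmx.
Proof.
move=> ->; rewrite mul2n -addnn; exists (block_mx 0 1%:M (- 1%:M) 0).
  by rewrite tr_block_mx !trmx0 linearN /= trmx1 opp_block_mx oppr0 opprK.
suff : block_mx 0 1%:M (- 1%:M) 0 *m block_mx 0 (- 1%:M) 1%:M 0 = 1%:M :> 'M[R]_(d + d).
  by case/mulmx1_unit.
rewrite mulmx_block !mulmx0 !mul0mx !mulmx1 ?mul1mx mulNmx mulmxN mulmx1 opprK.
by rewrite !addr0 !add0r -scalar_mx_block.
Qed.

Lemma boost_invmx (R : realFieldType) n (S : 'M[R]_n.+1) p q z : S^T = S ->
  hyperbolic_pair S p q -> z != 0 -> invmx (boost S p q z) = boost S p q z^-1.
Proof.
move=> symS pq z0.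
have e : boost S p q z *m boost S p q z^-1 = 1%:M.
  by rewrite boostM ?invr_eq0 // mulfV // boost1.
have [bu _] := mulmx1_unit e.
by apply: (can_inj (mulKmx bu)); rewrite mulmxV.
Qed.

Section Closure.
Variables (R : realType) (n d N : nat) (S : 'M[R]_n.+1) (G : set 'M[int]_n.+1).
Variables (h : 'M[int]_n.+1) (p q : 'rV[R]_n.+1) (lam : R).
Hypotheses (nd : n.+1 = (2 * d)%N) (N0 : (0 < N)%N).
Hypotheses (symS : S^T = S) (lorS : lorentzian S) (Su : S \in unitmx).
Hypothesis GS : forall g, G g -> realmx R g *m S *m (realmx R g)^T = S.
Hypotheses (G1 : G 1%:M) (GM : forall g k, G g -> G k -> G (g *m k)).
Hypothesis GV : forall g, G g -> G (invmx g).
Hypothesis Gu : forall g, G g -> g \in unitmx.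
Hypothesis irr : irreducible_on [set realmx R g | g in G].
Hypotheses (Gh : G h) (lam1 : 1 < lam) (pq : hyperbolic_pair S p q).
Hypotheses (ph : p *m realmx R h = lam *: p) (qh : q *m realmx R h = lam^-1 *: q).

(** Conditions on B rather than on g: together, the equations that G satisfies
    for these B are stable under translation by G, unlike the single equation
    det (g^N - 1) = 0. *)
Definition vanishing (B : 'M[R]_n.+1) :=
  forall g, G g -> \det ((realmx R g *m B) ^+ N - 1%:M) = 0.

(** The isometries that preserve this family of equations, a group that plays the
    part of the Zariski closure of G. *)
Definition closure_group : set 'M[R]_n.+1 := [set y |
  [/\ y *m S *m y^T = S, forall B, vanishing B -> vanishing (y *m B) &
      forall B, vanishing B -> vanishing (invmx y *m B)]].
Local Notation Gam := closure_group.

Lemma closure_group_unit y : Gam y -> y \in unitmx.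
Proof. by case=> /(isometry_unitmx Su). Qed.

Lemma closure_group1 : Gam 1%:M.
Proof.
by split=> [|B|B]; rewrite ?invmx1 ?mul1mx ?trmx1 ?mulmx1.
Qed.

Lemma closure_groupM y z : Gam y -> Gam z -> Gam (y *m z).
Proof.
move=> Gy Gz; have yu := closure_group_unit Gy; have zu := closure_group_unit Gz.
case: Gy Gz => yS yP yV [zS zP zV]; split.
- by rewrite trmx_mul !mulmxA -(mulmxA y) -(mulmxA y) zS.
- by move=> B vB; rewrite -mulmxA; apply/yP/zP.
- move=> B vB; have -> : invmx (y *m z) = invmx z *m invmx y.
    have yzu : y *m z \in unitmx by rewrite unitmx_mul yu.
    by apply: (can_inj (mulKmx yzu)); rewrite mulmxV // mulmxA mulmxK // mulmxV.
  by rewrite -mulmxA; apply/zV/yV.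
Qed.

Lemma closure_groupV y : Gam y -> Gam (invmx y).
Proof.
move=> Gy; have yu := closure_group_unit Gy; case: Gy => yS yP yV; split=> //.
  exact: isometry_invmx.
by rewrite invmxK.
Qed.

Lemma closure_group_sub g : G g -> Gam (realmx R g).
Proof.
move=> Gg.
have H k B : G k -> vanishing B -> vanishing (realmx R k *m B).
  by move=> Gk vB f Gf; rewrite mulmxA -realmxM; apply: vB; exact: GM.
split; first exact: GS.
- by move=> B; exact: H.
- move=> B; have -> : invmx (realmx R g) = realmx R (invmx g).
    have gu : realmx R g \in unitmx by apply: (isometry_unitmx Su); exact: GS.
    apply: (can_inj (mulKmx gu)); rewrite mulmxV // -realmxM mulmxV ?Gu //.
    by rewrite /realmx map_mx1.
  by apply: H; exact: GV.
Qed.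

(** The powers of h belong to G, and boost_propagation passes from them to the
    boosts. *)
Lemma closure_group_boost z : z != 0 -> Gam (boost S p q z).
Proof.
have H w B : w != 0 -> vanishing B -> vanishing (boost S p q w *m B).
  move=> w0 vB g Gg; rewrite mulmxA.
  apply: (boost_propagation symS lorS pq (GS Gh) lam1 ph qh) => // k.
  have -> : realmx R h ^+ k = realmx R (h ^+ k) by rewrite /realmx rmorphXn.
  rewrite -realmxM; apply: vB; apply: GM => //.
  elim: k => [|k IH]; first by rewrite expr0.
  by rewrite exprS -mulmxE; exact: GM.
move=> z0; split; first exact: boost_isometry.
- by move=> B; exact: H.
- by move=> B; rewrite boost_invmx //; apply: H; rewrite invr_eq0.
Qed.

Lemma closure_group_irreducible : irreducible_on Gam.
Proof.
move=> V st; apply: irr => y [g Gg <-]; apply: st; exact: closure_group_sub.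
Qed.

(** If every g failed, so would every element of closure_group, by taking B = 1.
    But all the S J with J skew are tangent to this group, and some are
    invertible because the rank is even. *)
Lemma exists_no_root_of_unity :
  exists2 g, G g & \det (realmx R g ^+ N - 1%:M) != 0.
Proof.
apply: contrapT => no.
have v1 : vanishing 1%:M.
  move=> g Gg; rewrite mulmx1; apply/eqP; apply: contraT => ne.
  by case: no; exists g.
have [J skJ Ju] := exists_skew_unit R nd.
have tJ : tangent Gam (S *m J).
  apply: (@skew_ind_axis_bivectors R n p q Gam _ (fun X => tangent Gam (S *m X)) J) => //.
  - move=> K; apply: (null_on_axes_eq0 symS lorS pq _ closure_group_unit closure_group1 closure_groupM
      closure_groupV closure_group_boost closure_group_irreducible).
    by move=> y [].
  - by rewrite mulmx0; exact: tangent0 closure_group1.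
  - by move=> X Y tX tY; rewrite mulmxDr; exact: (tangentD closure_groupM tX tY).
  - by move=> c X tX; rewrite -scalemxAr; exact: tangentZ.
  - move=> a b ab; apply: tangent_boost => z z0.
    apply: (axis_boost _ closure_group_unit closure_groupM closure_groupV closure_group_boost ab z0).
    by move=> y [].
have [y [_ yP _] y0] := tangent_unit_det_neq0 N0 (etrans (unitmx_mul _ _) (introT andP (conj Su Ju))) tJ.
by have := yP _ v1 _ G1; rewrite /realmx map_mx1 mul1mx mulmx1; apply/eqP.
Qed.
End Closure.

Theorem theorem4p1 (R : realType) (t d : nat) (S : 'M[int]_(1 + t))
  (C : set 'rV[R]_(1 + t)) (G : set 'M[int]_(1 + t))
  (hL : hyperbolic_lattice R S)
  (hd : (1 + t = 2 * d)%N)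
  (hC : positive_cone S C)
  (hG : is_subgroup (SOplus S C) G)
  (hirr : forall V : {vspace 'rV[R]_(1 + t)},
     stable G V -> V = 0%VS \/ V = fullv) :
  exists g : 'M[int]_(1 + t), G g /\ salem_polynomial R d (char_poly g).
Proof.
have [t0 Ssym sig] := hL; have [lorS Su] := signature_lorentzian sig.
have [GSO G1 GM GV] := hG.
have symS : (realmx R S)^T = realmx R S.
  rewrite /realmx map_trmx; congr (map_mx _ _); apply: bform_inj => x y.
  by rewrite bform_trmx Ssym.
have Gu g : G g -> g \in unitmx by case/GSO => -[].
have GS g : G g -> realmx R g *m realmx R S *m (realmx R g)^T = realmx R S.
  case/GSO => -[_ gS] _ _; rewrite /realmx map_trmx -!map_mxM; congr (map_mx _ _).
  by apply: bform_inj => x y; rewrite -gS /bform trmx_mul !mulmxA.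
have [x0 x0pos CE] := hC.
have Cx0 : C x0 by rewrite CE; exact: connected_component_refl.
have Cg g : G g -> C (x0 *m realmx R g) by case/GSO => _ _ <-; exists x0.
have sgn g a : G g -> a != 0 -> 0 <= bform (realmx R S) a a ->
    0 < bform (realmx R S) a x0 * bform (realmx R S) a (x0 *m realmx R g).
  move=> Gg a0 aa; apply: (component_same_sign (x0 := x0)) => //.
    by rewrite CE in Cx0.
  by have := Cg g Gg; rewrite CE.
have irr : irreducible_on [set realmx R g | g in G].
  by move=> V st; apply: hirr => g Gg v vV; apply: st => //; exists g.
have [N [N0 kro]] := kronecker R[i] t.+1.
have pos g : G g -> 0 < bform (realmx R S) x0 (x0 *m realmx R g).
  move=> Gg; have x00 : x0 != 0 by apply: contraTneq x0pos => ->; rewrite /positive_vectors /= bform0l ltxx.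
  by have := sgn g x0 Gg x00 (ltW x0pos); rewrite pmulr_rgt0.
have [h Gh [z hz z1]] := exists_expanding_element t0 irr G1 GM Gu pos.
have [lam [p [q [lam1 _ pq ph qh]]]] : exists lam p q, [/\ 1 < lam, z = lam%:C%C,
    hyperbolic_pair (realmx R S) p q, p *m realmx R h = lam *: p & q *m realmx R h = lam^-1 *: q].
  apply: (loxodromic_data symS lorS Su (GS h Gh) (fun a => sgn h a Gh) _ z1).
  by rewrite map_realmxC -map_char_poly.
have [g Gg gN] := exists_no_root_of_unity hd N0 symS lorS Su GS G1 GM GV Gu irr Gh lam1 pq ph qh.
exists g; split=> //; have [_ detg _] := GSO g Gg.
exact: (salem_char_poly hd kro symS lorS Su (GS g Gg) (fun a => sgn g a Gg) detg gN).
Qed.
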